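(* Let $\mathcal Y\subset\mathbb R^d$ be a finite set such that no element of $\mathcal Y$ is a strict convex combination of other elements, let $Y$ be the matrix with columns $y\in\mathcal Y$, $\varepsilon>0$, and $\mathbf Z$ a standard multivariate normal random vector on $\mathbb R^d$. Define $F_{\varepsilon,\Delta}:\mathbb R^{\mathcal Y}\to\mathbb R$ by $$F_{\varepsilon,\Delta}(s)=\mathbb E\big[\max_{y\in\mathcal Y}s(y)+\varepsilon\mathbf Z^\top y\big]=\mathbb E\big[\max_{q\in\Delta^{\mathcal Y}}(s+\varepsilon Y^\top\mathbf Z)^\top q\big].$$ Then: (1) $F_{\varepsilon,\Delta}$ is convex and Lipschitz continuous (in particular proper, l.s.c. and convex). (2) $F_{\varepsilon,\Delta}$ is strictly convex on $V_\Delta$ and affine on $V_\Delta^\perp=\operatorname{span}(\mathbf 1)$; more precisely, for $s=s_{V_\Delta}+s_{V_\Delta^\perp}$ with $s_{V_\Delta}$ the orthogonal projection of $s$ onto $V_\Delta$ and for any $q_0\in\Delta^{\mathcal Y}$, $F_{\varepsilon,\Delta}(s)=\langle s_{V_\Delta^\perp}|q_0\rangle+F_{\varepsilon,\Delta}(s_{V_\Delta})$. (3) $F_{\varepsilon,\Delta}$ is differentiable on $\mathbb R^{\mathcal Y}$ with $\nabla F_{\varepsilon,\Delta}(s)=\mathbb E\big[\operatorname{argmax}_{q\in\Delta^{\mathcal Y}}(s+\varepsilon Y^\top\mathbf Z)^\top q\big]$ (the argmax being almost surely a singleton). (4) The Fenchel conjugate $\Omega_{\varepsilon,\Delta}:=F_{\varepsilon,\Delta}^*$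 has domain $\Delta^{\mathcal Y}$, and its restriction to the affine hull $H_\Delta$ of $\Delta^{\mathcal Y}$ is Legendre-type.
   Context: $\mathbb R^{\mathcal Y}$ is the space of vectors indexed by $\mathcal Y$ with components $s(y)$; $\Delta^{\mathcal Y}=\{q\in\mathbb R^{\mathcal Y}:q\ge0,\sum_yq_y=1\}$; $H_\Delta$ is its affine hull and $V_\Delta=\{v\in\mathbb R^{\mathcal Y}:\sum_yv_y=0\}$ its direction. A function is Legendre-type if it is strictly convex on the interior of its domain and essentially smooth (nonempty interior of the domain, differentiable there, gradient norm tending to $+\infty$ at the boundary of the domain); for a restriction to an affine subspace this is with respect to that subspace's metric. *)

(* Defs.v *)
From HB Require Import structures.
From mathcomp Require Import all_boot all_order all_algebra.
From mathcomp Require Import all_classical all_reals all_analysis.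
Set Implicit Arguments. Unset Strict Implicit. Unset Printing Implicit Defensive.
Import Order.TTheory GRing.Theory Num.Theory.
Import numFieldNormedType.Exports.
Local Open Scope classical_set_scope.
Local Open Scope ring_scope.

Section Defs.
Variable R : realType.

(* Expectation E[g(Z)] for Z a standard normal vector of R^d, written as the
   iterated Lebesgue integral against the product density
   prod_k phi(z_k), phi the standard normal density (Fubini). *)
Fixpoint gauss_expect (d : nat) : ('rV[R]_d -> R) -> R :=
  match d with
  | 0 => fun g => g 0
  | d'.+1 => fun g =>
      Rintegral (@lebesgue_measure R) setT
        (fun t : R => normal_pdf 0 1 t *
           gauss_expect (fun z : 'rV[R]_d' => g (row_mx (\row_(_ < 1) t) z)))
  end.

Definition gauss_prob (d : nat) (A : set 'rV[R]_d) : R :=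
  gauss_expect (fun z => \1_A z).

Definition vdot (n : nat) (a b : 'rV[R]_n) : R := \sum_(i < n) a 0 i * b 0 i.

(* max_i v_i (for n > 0) *)
Definition vmax (n : nat) (v : 'rV[R]_n) : R :=
  fine (\big[Order.max/-oo%E]_(i < n) (v 0 i)%:E).

Definition simplex (n : nat) : set 'rV[R]_n :=
  [set q | (forall i, 0 <= q 0 i) /\ \sum_(i < n) q 0 i = 1].
Definition aff_simplex (n : nat) : set 'rV[R]_n :=
  [set q | \sum_(i < n) q 0 i = 1].
Definition Vdelta (n : nat) : set 'rV[R]_n :=
  [set v | \sum_(i < n) v 0 i = 0].

Definition proj_perp (n : nat) (s : 'rV[R]_n) : 'rV[R]_n :=
  ((\sum_(i < n) s 0 i) / n%:R) *: const_mx 1.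
Definition proj_V (n : nat) (s : 'rV[R]_n) : 'rV[R]_n := s - proj_perp s.

Definition argmax_simplex (n : nat) (v : 'rV[R]_n) : set 'rV[R]_n :=
  [set q | @simplex n q /\ forall q', @simplex n q' -> vdot v q' <= vdot v q].

Definition Feps (d n : nat) (Y : 'M[R]_(d, n)) (eps : R) (s : 'rV[R]_n) : R :=
  gauss_expect (fun z : 'rV[R]_d => vmax (s + eps *: (z *m Y))).

Definition fenchel (n : nat) (F : 'rV[R]_n -> R) (q : 'rV[R]_n) : \bar R :=
  ereal_sup [set (vdot s q - F s)%:E | s in [set: 'rV[R]_n]].

(* ---- Legendre type for a function restricted to an affine subspace H
        with direction V (norms: any norm on R^n, they are equivalent) *)
Definition dom_in (n : nat) (H : set 'rV[R]_n) (f : 'rV[R]_n -> \bar R) :=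
  [set x | H x /\ (f x < +oo)%E].

Definition relint_in (n : nat) (H A : set 'rV[R]_n) : set 'rV[R]_n :=
  [set x | A x /\ exists2 e : R, 0 < e &
     forall z, H z -> `|z - x| < e -> A z].

Definition grad_in (n : nat) (V : set 'rV[R]_n) (f : 'rV[R]_n -> \bar R)
    (x g : 'rV[R]_n) : Prop :=
  V g /\ f x \is a fin_num /\
  forall e : R, 0 < e -> exists2 del : R, 0 < del &
    forall h, V h -> `|h| < del ->
      f (x + h) \is a fin_num /\
      `|fine (f (x + h)) - fine (f x) - vdot g h| <= e * `|h|.

Definition strictly_convex_on (n : nat) (A : set 'rV[R]_n)
    (f : 'rV[R]_n -> \bar R) : Prop :=
  forall x y (t : R), A x -> A y -> x != y -> 0 < t < 1 ->
    (f (t *: x + (1 - t) *: y)%R < t%:E * f x + (1 - t)%:E * f y)%E.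

Definition essentially_smooth_in (n : nat) (H V : set 'rV[R]_n)
    (f : 'rV[R]_n -> \bar R) : Prop :=
  let D := relint_in H (dom_in H f) in
  D !=set0 /\
  (forall x, D x -> exists g, grad_in V f x g) /\
  (forall (u g : nat -> 'rV[R]_n) (x : 'rV[R]_n),
      (forall k, D (u k)) -> u @ \oo --> x -> ~ D x ->
      (forall k, grad_in V f (u k) (g k)) ->
      (fun k => `|g k|) @ \oo --> +oo).

Definition legendre_in (n : nat) (H V : set 'rV[R]_n)
    (f : 'rV[R]_n -> \bar R) : Prop :=
  strictly_convex_on (relint_in H (dom_in H f)) f /\
  essentially_smooth_in H V f.

End Defs.

(* Main.v *)
(** The integrand [vmax (s + eps Z Y)] is Lipschitz, convex and translation
    equivariant in [s], so these properties pass to [F], as does the bound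
    [|F - vmax| <= C], which gives the domain of the conjugate.

    If [F] is not strictly convex between [s1] and [s2], then for every value
    of the noise the two perturbed problems share a maximizer; the difference of
    their values is then continuous and takes finitely many values, hence is
    constant, and letting the noise expose each vertex in turn shows that
    [s1 - s2] is constant.  Exposing a vertex also gives [F s - F (s - e_i) > 0].

    One-sided partial derivatives of [F] exist by dominated convergence; they
    agree because ties lie in finitely many hyperplanes, which are null sets.
    Convexity upgrades partial derivatives to Frechet differentiability.

    On the relative interior of the simplex the supremum defining the conjugate
    is attained at a unique point [s] of [V_Delta]; strict convexity of [F] makes
    [s] the gradient there.  Strict convexity of the conjugate follows from the
    uniqueness of the gradient of [F] at [s].  As [x_i >= F s - F (s - e_i)], the
    coordinates of [x] are bounded below for bounded [s], whence the blow-up of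
    the gradient at the boundary. *)
Require Import Defs.
From HB Require Import structures.
From mathcomp Require Import all_boot all_order all_algebra.
From mathcomp Require Import all_classical all_reals all_analysis.
From mathcomp Require Import measurable_realfun ring lra.
Set Implicit Arguments. Unset Strict Implicit. Unset Printing Implicit Defensive.
Import Order.TTheory GRing.Theory Num.Theory.
Import numFieldNormedType.Exports.
Local Open Scope classical_set_scope.
Local Open Scope ring_scope.

(** * Iterated Gaussian expectation: first moment, linearity, dominated convergence *)

Section GaussianExpectation.
Variable R : realType.
Notation mu := (@lebesgue_measure R).
Notation phi := (normal_pdf (0 : R) 1).
Notation E := gauss_expect.

Definition slice (d : nat) (g : 'rV[R]_d.+1 -> R) (t : R) : 'rV[R]_d -> R :=
  fun z => g (row_mx (\row_(_ < 1) t) z).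

(* Excludes the junk value of [Rintegral] at every stage of the iterated integral. *)
Fixpoint gauss_integrable (d : nat) : ('rV[R]_d -> R) -> Prop :=
  match d with
  | 0 => fun=> True
  | d'.+1 => fun g => (forall t, gauss_integrable (slice g t)) /\
      mu.-integrable setT (EFin \o (fun t => phi t * E (slice g t)))
  end.

Lemma gauss_expectS d (g : 'rV[R]_d.+1 -> R) :
  E g = Rintegral mu setT (fun t => phi t * E (slice g t)).
Proof. by []. Qed.

Lemma normal_pdf_gt0 (t : R) : 0 < phi t.
Proof.
rewrite normal_pdfE ?oner_neq0//.
by apply: mulr_gt0; [rewrite normal_peak_gt0 ?oner_neq0|exact: expR_gt0].
Qed.

Lemma integrable_normal_pdf_cst (c : R) :
  mu.-integrable setT (EFin \o (fun t => phi t * c)).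
Proof.
have := integrableZl measurableT c (integrable_normal_pdf 0 (1 : R)).
by apply: eq_integrable => // x _ /=; rewrite mulrC EFinM.
Qed.

Lemma Rintegral_normal_pdf_cst (c : R) :
  Rintegral mu setT (fun t => phi t * c) = c.
Proof.
rewrite RintegralZr//; last exact: integrable_normal_pdf.
by rewrite /Rintegral integral_normal_pdf/= mul1r.
Qed.

(* From [|t| <= 2 exp (t^2/4)]: the first moment is dominated by a multiple
   of the density with standard deviation [sqrt 2]. *)
Lemma integrable_normal_pdf_norm :
  mu.-integrable setT (EFin \o (fun t => phi t * `|t|)).
Proof.
pose s : R := Num.sqrt 2.
have s0 : s != 0 by rewrite gt_eqF// sqrtr_gt0.
(* The 2 is the factor in the bound on [|t|]; the ratio of peaks trades one normalization for the
   other. *)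
pose c : R := 2 * normal_peak 1 / normal_peak s.
have ic : mu.-integrable setT (EFin \o (fun t => c * normal_pdf 0 s t)).
  have := integrableZl measurableT c (integrable_normal_pdf 0 s).
  by apply: eq_integrable => // x _ /=; rewrite EFinM.
apply: le_integrable ic => //.
  apply/measurable_EFinP; apply: measurable_funM.
    exact: measurable_normal_pdf.
  exact: normr_measurable.
have p1 : 0 < normal_peak (1 : R) by rewrite normal_peak_gt0 ?oner_neq0.
have ps : 0 < normal_peak s by rewrite normal_peak_gt0.
have c0 : 0 <= c by rewrite divr_ge0 ?mulr_ge0 ?(ltW p1) ?(ltW ps).
move=> t _ /=; rewrite lee_fin.
rewrite [leLHS]ger0_norm ?mulr_ge0 ?normal_pdf_ge0//.
rewrite [leRHS]ger0_norm; last exact: mulr_ge0 (normal_pdf_ge0 _ _ _).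
rewrite !normal_pdfE ?oner_neq0//.
have -> : c * (normal_peak s * normal_fun 0 s t) =
    normal_peak 1 * (2 * normal_fun 0 s t).
  by rewrite /c; field; rewrite gt_eqF.
rewrite -mulrA ler_pM2l// /normal_fun !subr0 expr1n.
rewrite sqr_sqrtr//.
have -> : - t ^+ 2 / 2%:R = - (t ^+ 2 / (2 *+ 2)) + - t ^+ 2 / (2 *+ 2) :> R.
  by rewrite -mulr_natr; field.
rewrite expRD [_ * `|t|]mulrAC ler_pM2r ?expR_gt0//.
rewrite expRN mulrC ler_pdivrMr ?expR_gt0//.
have := expR_ge1Dx (t ^+ 2 / (2 *+ 2)).
have := sqr_ge0 (`|t| - 2); rewrite -mulr_natr -(real_normK (num_real t)).
set e := expR _; move=> h1 h2; nra.
Qed.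

Lemma gauss_cst d (c : R) :
  gauss_integrable (fun _ : 'rV[R]_d => c) /\ E (fun _ : 'rV[R]_d => c) = c.
Proof.
elim: d => [//|d [IH1 IH2]]; have h t : E (slice (fun _ : 'rV[R]_d.+1 => c) t) = c.
  exact: IH2.
split.
  split=> [t|]; first exact: IH1.
  apply: eq_integrable (integrable_normal_pdf_cst c) => // x _ /=.
  by rewrite h.
rewrite gauss_expectS; under eq_Rintegral do rewrite h.
exact: Rintegral_normal_pdf_cst.
Qed.

Lemma gauss_lin d (a : R) (f g : 'rV[R]_d -> R) :
  gauss_integrable f -> gauss_integrable g ->
  gauss_integrable (fun z => a * f z + g z) /\
  E (fun z => a * f z + g z) = a * E f + E g.
Proof.
elim: d f g => [//|d IH] f g [f1 f2] [g1 g2].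
have IHt t := IH _ _ (f1 t) (g1 t).
have h t : phi t * E (slice (fun z => a * f z + g z) t) =
    a * (phi t * E (slice f t)) + phi t * E (slice g t).
  by rewrite (IHt t).2 mulrDr mulrCA.
have af : mu.-integrable setT (EFin \o (fun t => a * (phi t * E (slice f t)))).
  have := integrableZl measurableT a f2.
  by apply: eq_integrable => // x _ /=; rewrite EFinM.
split.
  split=> [t|]; first exact: (IHt t).1.
  apply: eq_integrable (integrableD measurableT af g2) => // x _ /=.
  by rewrite h EFinD.
rewrite gauss_expectS; under eq_Rintegral do rewrite h.
by rewrite RintegralD// RintegralZl.
Qed.

Lemma gauss_le d (f g : 'rV[R]_d -> R) :
  gauss_integrable f -> gauss_integrable g -> (forall z, f z <= g z) ->
  E f <= E g.
Proof.
elim: d f g => [|d IH] f g; first by move=> _ _; exact.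
move=> [f1 f2] [g1 g2] fg; rewrite !gauss_expectS le_Rintegral// => t _.
rewrite ler_wpM2l ?normal_pdf_ge0//; apply: (IH _ _ (f1 t) (g1 t)) => z; exact: fg.
Qed.

Lemma gauss_norm_le d (f G : 'rV[R]_d -> R) :
  gauss_integrable f -> gauss_integrable G -> (forall z, `|f z| <= G z) ->
  `|E f| <= E G.
Proof.
move=> fi Gi fG; have [c1 c2] := gauss_cst d 0.
have [Gk Gk2] := gauss_lin (-1) Gi c1.
rewrite c2 addr0 mulN1r in Gk2.
rewrite ler_norml -Gk2; apply/andP; split; apply: gauss_le => // z.
  by rewrite mulN1r addr0; have := fG z; rewrite ler_norml => /andP[].
by have := fG z; rewrite ler_norml => /andP[].
Qed.

(** Induction on the dimension: the inner expectations converge slice by slice, and the outer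
    integrands are dominated by [phi t * E (slice G t)]. Integrability of the limit is part of the
    conclusion, which later covers discontinuous limits such as indicators of maximizers. *)
Lemma gauss_dominated d (f : nat -> 'rV[R]_d -> R) (g G : 'rV[R]_d -> R) :
  (forall k, gauss_integrable (f k)) -> gauss_integrable G ->
  (forall k z, `|f k z| <= G z) -> (forall z, f ^~ z @ \oo --> g z) ->
  gauss_integrable g /\ E (f k) @[k --> \oo] --> E g.
Proof.
elim: d f g G => [|d IH] f g G.
  by move=> _ _ _ h; split=> //; exact: h.
move=> fi [G1 G2] fG fg.
have IHt t := IH (fun k => slice (f k) t) (slice g t) (slice G t)
  (fun k => (fi k).1 t) (G1 t) (fun k z => fG k _) (fun z => fg _).
pose u k := EFin \o (fun t => phi t * E (slice (f k) t)).
pose l := EFin \o (fun t => phi t * E (slice g t)).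
have ul t : u ^~ t @ \oo --> l t.
  apply: cvg_EFin; first by near=> k.
  by apply: cvgM; [exact: cvg_cst|exact: (IHt t).2].
have uG k t : (`|u k t| <= (phi t * E (slice G t))%:E)%E.
  rewrite /= lee_fin normrM ger0_norm ?normal_pdf_ge0// ler_wpM2l ?normal_pdf_ge0//.
  by apply: gauss_norm_le => [||z]; [exact: (fi k).1|exact: G1|exact: fG].
have mu_ k : measurable_fun setT (u k) by case/integrableP: ((fi k).2).
have ml : measurable_fun setT l.
  by apply: (emeasurable_fun_cvg _ _ mu_) => t _; exact: ul.
have [il _ cl] : [/\ mu.-integrable setT l,
    [sequence (\int[mu]_x `|u n x - l x|)%E]_n @ \oo --> 0%E &
    [sequence (\int[mu]_x u n x)%E]_n @ \oo --> (\int[mu]_x l x)%E].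
  apply: (@dominated_convergence _ _ R mu setT measurableT u l _ _ _ _ G2) => //.
    by apply: aeW => t _; exact: ul.
  by apply: aeW => t k _; exact: uG.
split; first by split=> // t; exact: (IHt t).1.
have := cl; rewrite -[X in _ --> X -> _](@fineK _ (\int[mu]_x l x)%E); last first.
  exact: integrable_fin_num.
by move=> /fine_cvg.
Unshelve. all: by end_near.
Qed.

End GaussianExpectation.

(** * Lipschitz integrands, vanishing expectations and null hyperplanes *)

Section LipschitzRows.
Variable R : realType.

(** The l1 distance is additive under splitting off the first coordinate, so slices keep the
    Lipschitz constant. *)
Definition dist1 (d : nat) (a b : 'rV[R]_d) : R := \sum_(i < d) `|a 0 i - b 0 i|.
Definition lipschitz1 (d : nat) (k : R) (g : 'rV[R]_d -> R) :=
  0 <= k /\ forall a b, `|g a - g b| <= k * dist1 a b.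

Lemma dist1_ge0 d (a b : 'rV[R]_d) : 0 <= dist1 a b.
Proof. exact: sumr_ge0. Qed.

Lemma dist1_row_mx d (s t : R) (y z : 'rV[R]_d) :
  dist1 (row_mx (\row_(_ < 1) s) y) (row_mx (\row_(_ < 1) t) z) =
  `|s - t| + dist1 y z.
Proof.
rewrite /dist1 big_split_ord/= big_ord1 !row_mxEl !mxE; congr +%R.
by apply: eq_bigr => i _; rewrite !row_mxEr.
Qed.

Lemma lipschitz1_cst d (c : R) : lipschitz1 0 (fun _ : 'rV[R]_d => c).
Proof. by split=> // a b; rewrite subrr normr0 mul0r. Qed.

Lemma lipschitz1_lin d k l (a : R) (f g : 'rV[R]_d -> R) :
  lipschitz1 k f -> lipschitz1 l g ->
  lipschitz1 (`|a| * k + l) (fun z => a * f z + g z).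
Proof.
move=> [k0 kf] [l0 lg]; split=> [|y z]; first by rewrite addr_ge0 ?mulr_ge0.
rewrite (_ : _ - _ = a * (f y - f z) + (g y - g z)); last by ring.
rewrite (le_trans (ler_normD _ _))// mulrDl lerD// normrM -mulrA.
by rewrite ler_wpM2l.
Qed.

Lemma lipschitz1_slice d k (g : 'rV[R]_d.+1 -> R) t :
  lipschitz1 k g -> lipschitz1 k (slice g t).
Proof.
move=> [k0 kg]; split=> // y z.
by rewrite (le_trans (kg _ _))// dist1_row_mx subrr normr0 add0r.
Qed.

Lemma gauss_slice_dist d k (g : 'rV[R]_d.+1 -> R) s t : lipschitz1 k g ->
  gauss_integrable (slice g s) -> gauss_integrable (slice g t) ->
  `|gauss_expect (slice g s) - gauss_expect (slice g t)| <= k * `|s - t|.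
Proof.
move=> [k0 kg] gs gt.
have [i1 i2] := gauss_lin (-1) gt gs.
have [c1 c2] := gauss_cst d (k * `|s - t|).
rewrite [X in `|X|](_ : _ =
  -1 * gauss_expect (slice g t) + gauss_expect (slice g s)); last by ring.
rewrite -i2 -c2; apply: gauss_norm_le => // z.
rewrite mulN1r addrC (le_trans (kg _ _))// dist1_row_mx.
rewrite (_ : dist1 z z = 0) ?addr0//.
by apply: big1 => i _; rewrite subrr normr0.
Qed.

Lemma lipschitz_continuous (V : normedModType R) (h : V -> R) k : 0 <= k ->
  (forall s t, `|h s - h t| <= k * `|s - t|) -> continuous h.
Proof.
move=> k0 hk t; apply/cvgrPdist_le => e e0; near=> s.
rewrite (le_trans (hk _ _))// (@le_trans _ _ ((k + 1) * `|t - s|))//.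
  by rewrite ler_wpM2r// lerDl.
rewrite -ler_pdivlMl ?ltr_wpDl//; near: s.
by apply: cvgr_dist_le => //; rewrite mulr_gt0// invr_gt0 ltr_wpDl.
Unshelve. all: by end_near.
Qed.

(** The expectation of the slice at [t] is again Lipschitz in [t], hence measurable and of at most
    linear growth; the first moment of the density then dominates it. *)
Lemma gauss_lipschitz1 d k (g : 'rV[R]_d -> R) :
  lipschitz1 k g -> gauss_integrable g.
Proof.
elim: d g => [//|d IH] g kg.
have ig t : gauss_integrable (slice g t) by exact: IH (lipschitz1_slice t kg).
split=> [//|]; pose h t := gauss_expect (slice g t).
have hlip s t : `|h s - h t| <= k * `|s - t| by exact: gauss_slice_dist.
have ch : continuous h by apply: lipschitz_continuous hlip; case: kg.
have [k0 _] := kg.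
have := integrableD measurableT (integrable_normal_pdf_cst `|h 0|)
  (integrableZl measurableT k (integrable_normal_pdf_norm R)).
apply: le_integrable => //.
  apply/measurable_EFinP; apply: measurable_funM.
    exact: measurable_normal_pdf.
  exact: continuous_measurable_fun.
move=> t _ /=; rewrite lee_fin normrM ger0_norm ?normal_pdf_ge0//.
rewrite [leRHS]ger0_norm; last first.
  by rewrite addr_ge0 ?mulr_ge0 ?normal_pdf_ge0.
rewrite mulrCA -mulrDr ler_wpM2l ?normal_pdf_ge0//.
rewrite -lerBlDl (le_trans (lerB_dist _ _))// (le_trans (hlip _ _))//.
by rewrite subr0.
Qed.

(** A positive value [u t] would keep [u] above [u t / 2] on an interval of length [2 r], which
    already makes the integral positive. *)
Lemma continuous_Rintegral_eq0 (u : R -> R) : continuous u ->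
  (forall t, 0 <= u t) ->
  (@lebesgue_measure R).-integrable setT (EFin \o u) ->
  Rintegral lebesgue_measure setT u = 0 -> forall t, u t = 0.
Proof.
move=> cu u0 iu Iu t; apply/eqP; rewrite eq_le u0 andbT leNgt; apply/negP => ut.
have ut2 : u t / 2 < u t by rewrite ltr_pdivrMr// ltr_pMr// ltr1n.
have [r /= r0 hr] : exists2 r : R, 0 < r & forall s, `|t - s| < r -> u t / 2 <= u s.
  have /cvgr_ge/(_ _ ut2) := cu t; rewrite near_simpl => /nbhs_ballP[r r0 hr].
  by exists r => // s ts; exact: hr.
pose J : set R := `]t - r, t + r[%classic.
have iJ : (@lebesgue_measure R).-integrable setT (EFin \o (fun s => u t / 2 * \1_J s)).
  have := integrableZl measurableT (u t / 2) (@integrable_indic_itv R (t - r) (t + r) false true).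
  by apply: eq_integrable => // x _ /=; rewrite EFinM.
have : Rintegral lebesgue_measure setT (fun s => u t / 2 * \1_J s) <= 0.
  rewrite -Iu; apply: le_Rintegral => // s _; rewrite indicE.
  have [|_] := boolP (s \in J); last by rewrite mulr0.
  rewrite inE mulr1 => sJ; apply: hr.
  move: sJ; rewrite /J /= in_itv/= ltr_norml => /andP[? ?]; apply/andP; split; lra.
rewrite RintegralZl//; last exact: integrable_indic_itv.
have mJ : measurable J by exact: measurable_itv.
rewrite /Rintegral integral_indic// setIT [X in fine X](_ : _ = (r + r)%:E)/=.
  by apply/negP; rewrite -ltNge mulr_gt0//; lra.
have trr : t - r < t + r by lra.
apply: (etrans (lebesgue_measure_itv _)); rewrite /= lte_fin trr -EFinB.
by congr EFin; lra.
Qed.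

Lemma row_mx_head_tail d (z : 'rV[R]_d.+1) :
  z = row_mx (\row_(_ < 1) z 0 0) (rsubmx (z : 'rV_(1 + d))).
Proof.
apply: etrans (esym (@hsubmxK _ 1 1 d z)) _.
apply: (congr1 (fun u => row_mx u _)); apply/rowP => i; rewrite !mxE ord1.
by congr (z _ _); exact/val_inj.
Qed.

(** The density is positive and the integrand continuous, so the conclusion holds for every noise
    and not only almost every one. Equalities between expectations thereby become pointwise
    equalities. *)
Lemma gauss_expect_eq0 d k (g : 'rV[R]_d -> R) : lipschitz1 k g ->
  (forall z, 0 <= g z) -> gauss_expect g = 0 -> forall z, g z = 0.
Proof.
elim: d g => [|d IH] g kg g0 Eg z.
  by rewrite -Eg /=; congr g; apply/rowP => -[].
have ks t := lipschitz1_slice t kg.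
have ig t : gauss_integrable (slice g t) by exact: gauss_lipschitz1 (ks t).
pose h t := gauss_expect (slice g t).
have h0 t : 0 <= h t.
  have [c1 c2] := gauss_cst d (0 : R).
  by rewrite /h -c2; apply: gauss_le => // y; exact: g0.
have ch : continuous h.
  apply: (@lipschitz_continuous _ h k); first by case: kg.
  by move=> s t; exact: gauss_slice_dist.
have [_ ih] := gauss_lipschitz1 kg.
have := @continuous_Rintegral_eq0 (fun t => normal_pdf 0 1 t * h t).
move=> /(_ _ _ ih Eg) hz.
have {}hz t : h t = 0.
  have /eqP : normal_pdf 0 1 t * h t = 0.
    apply: hz => [s|s]; last by rewrite mulr_ge0// normal_pdf_ge0.
    apply: cvgM; last exact: ch.
    by apply: continuous_normal_pdf; exact: oner_neq0.
  by rewrite mulf_eq0 gt_eqF ?normal_pdf_gt0//= => /eqP.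
have := IH _ (ks (z 0 0)) (fun=> g0 _) (hz (z 0 0)) (rsubmx (z : 'rV_(1 + d))).
rewrite /slice => <-; congr g; exact: row_mx_head_tail.
Qed.

Lemma vdot_row_mx d (w : 'rV[R]_(1 + d)) t (z : 'rV[R]_d) :
  vdot w (row_mx (\row_(_ < 1) t) z) = w 0 (lshift d 0) * t + vdot (rsubmx w) z.
Proof.
rewrite /vdot big_split_ord big_ord1 row_mxEl mxE; congr +%R.
by apply: eq_bigr => i _; rewrite row_mxEr mxE.
Qed.

(** If the tail of [w] is nonzero, every slice is a hyperplane indicator in lower dimension;
    otherwise the slices are constant and vanish except at a single [t]. Integrability is proved
    alongside, as the indicator is not Lipschitz. *)
Lemma gauss_hyperplane d (a : R) (w : 'rV[R]_d) : w != 0 ->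
  let f := fun z : 'rV[R]_d => (a + vdot w z == 0)%:R : R in
  gauss_integrable f /\ gauss_expect f = 0.
Proof.
elim: d a w => [a w /eqP[]|d IH a w w0 f]; first by apply/rowP => -[].
pose w' := rsubmx (w : 'rV_(1 + d)).
have fE t (z : 'rV[R]_d) : slice f t z = (a + w 0 0 * t + vdot w' z == 0)%:R.
  rewrite /slice /f -addrA (vdot_row_mx (w : 'rV_(1 + d))); congr (_ + (w _ _ * _ + _) == _)%:R.
  exact/val_inj.
have [w'0|w'0] := eqVneq w' 0; last first.
  have fE2 t : slice f t = fun z => (a + w 0 0 * t + vdot w' z == 0)%:R.
    by apply/funext => z; exact: fE.
  have E0 t : gauss_expect (slice f t) = 0 by rewrite fE2; have [] := IH (a + w 0 0 * t) w' w'0.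
  split.
    split=> [t|]; first by rewrite fE2; have [] := IH (a + w 0 0 * t) w' w'0.
    apply: eq_integrable (integrable_normal_pdf_cst 0) => // t _ /=.
    by rewrite E0.
  rewrite gauss_expectS; under eq_Rintegral do rewrite E0.
  exact: Rintegral_normal_pdf_cst.
have w00 : w 0 0 != 0.
  apply: contra w0 => /eqP w00; apply/eqP; rewrite (row_mx_head_tail w) -/w' w'0 w00.
  by apply/rowP => i; rewrite mxE; case: splitP => j ij; rewrite !mxE.
pose x := - a / w 0 0.
have fE2 t : slice f t = fun=> (t == x)%:R.
  apply/funext => z; rewrite fE w'0 /vdot big1 ?addr0; last first.
    by move=> i _; rewrite mxE mul0r.
  congr (_ : bool)%:R; apply/eqP/eqP => [h|->]; last by rewrite /x; field.
  by rewrite /x; apply: (mulfI w00); rewrite mulrCA divff// mulr1; lra.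
have E0 t : gauss_expect (slice f t) = \1_[set x] t.
  by rewrite fE2 (gauss_cst d _).2 indicE; congr (_ : bool)%:R; apply/eqP/idP; rewrite inE.
have E1 : (fun t => normal_pdf 0 1 t * gauss_expect (slice f t)) =
    (normal_pdf 0 1 \_ [set x]).
  apply/funext => t; rewrite E0 patchE indicE; case: ifPn => _.
    by rewrite mulr1.
  by rewrite mulr0.
split.
  split=> [t|]; first by rewrite fE2; exact: (gauss_cst d _).1.
  rewrite E1 -restrict_EFin; apply/integrable_restrict => //; rewrite setTI.
  exact: integrableS (integrable_normal_pdf 0 1).
by rewrite gauss_expectS E1 -Rintegral_mkcond Rintegral_set1.
Qed.

End LipschitzRows.

(** * Row vectors: sup norm, maximum of coordinates, inner product, compactness *)

Section RowVectors.
Variable R : realType.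

Lemma norm_coord_le n (v : 'rV[R]_n) i : `|v 0 i| <= `|v|.
Proof. by rewrite [leRHS]/Num.norm/= mx_normrE; apply: (le_bigmax _ _ (0, i)). Qed.

Lemma norm_row_le n (v : 'rV[R]_n) m : 0 <= m -> (forall i, `|v 0 i| <= m) ->
  `|v| <= m.
Proof.
move=> m0 vm; rewrite [leLHS]/Num.norm/= mx_normrE; apply: bigmax_le => // -[i j] _.
by rewrite ord1.
Qed.

(** [vmax] applies [fine] to a maximum started at [-oo]; a nonempty index range keeps that maximum
    real. *)
Lemma vmax_attained n (v : 'rV[R]_n) : (0 < n)%N ->
  (forall i, v 0 i <= vmax v) /\ exists i, vmax v = v 0 i.
Proof.
case: n v => // n v _; pose m := (\big[Order.max/-oo%E]_(i < n.+1) (v 0 i)%:E)%E.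
have mge i : ((v 0 i)%:E <= m)%E by exact: le_bigmax.
have [moo|[i mi]] : m = -oo%E \/ exists i, m = (v 0 i)%:E.
- rewrite /m; elim/big_ind: _ => [|x y hx hy|i _]; [by left| |by right; exists i].
  by have [] := leP x y.
- by have := mge 0; rewrite moo.
- rewrite /vmax -/m; split; last by exists i; rewrite mi.
  by move=> j; have := mge j; rewrite mi lee_fin.
Qed.

Lemma vmax_le_shift n (a b : 'rV[R]_n) m : (0 < n)%N ->
  (forall i, a 0 i <= b 0 i + m) -> vmax a <= vmax b + m.
Proof.
move=> n0 ab; have [_ [i ->]] := vmax_attained a n0.
have [bm _] := vmax_attained b n0.
by rewrite (le_trans (ab i))// lerD2r.
Qed.

Lemma vmax_dist n (a b : 'rV[R]_n) m : (0 < n)%N ->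
  (forall i, `|a 0 i - b 0 i| <= m) -> `|vmax a - vmax b| <= m.
Proof.
move=> n0 ab; rewrite ler_norml; apply/andP; split.
  rewrite lerBrDr addrC lerBlDr; apply: vmax_le_shift => // i.
  by have := ab i; rewrite ler_norml => /andP[]; lra.
rewrite lerBlDl addrC addrC; apply: vmax_le_shift => // i.
by have := ab i; rewrite ler_norml => /andP[]; lra.
Qed.

Lemma vmax_convex n (a b : 'rV[R]_n) t : (0 < n)%N -> 0 <= t <= 1 ->
  vmax (t *: a + (1 - t) *: b) <= t * vmax a + (1 - t) * vmax b.
Proof.
move=> n0 /andP[t0 t1]; have [_ [i ->]] := vmax_attained (t *: a + (1 - t) *: b) n0.
have [am _] := vmax_attained a n0; have [bm _] := vmax_attained b n0.
by rewrite !mxE lerD// ler_wpM2l// subr_ge0.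
Qed.

Lemma vmaxD_le n (a b : 'rV[R]_n) : (0 < n)%N -> vmax (a + b) <= vmax a + vmax b.
Proof.
move=> n0; apply: vmax_le_shift => // i; rewrite mxE lerD2l.
by have [bm _] := vmax_attained b n0.
Qed.

Lemma vdotC n (a b : 'rV[R]_n) : vdot a b = vdot b a.
Proof. by apply: eq_bigr => i _; rewrite mulrC. Qed.

Lemma vdotDl n (a b c : 'rV[R]_n) : vdot (a + b) c = vdot a c + vdot b c.
Proof. by rewrite /vdot -big_split; apply: eq_bigr => i _; rewrite mxE mulrDl. Qed.

Lemma vdotZl n k (a c : 'rV[R]_n) : vdot (k *: a) c = k * vdot a c.
Proof. by rewrite /vdot big_distrr; apply: eq_bigr => i _; rewrite mxE /= mulrA. Qed.

Lemma vdotDr n (a b c : 'rV[R]_n) : vdot a (b + c) = vdot a b + vdot a c.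
Proof. by rewrite vdotC vdotDl !(vdotC _ a). Qed.

Lemma vdotZr n k (a c : 'rV[R]_n) : vdot a (k *: c) = k * vdot a c.
Proof. by rewrite vdotC vdotZl vdotC. Qed.

Lemma vdotNl n (a c : 'rV[R]_n) : vdot (- a) c = - vdot a c.
Proof. by rewrite -scaleN1r vdotZl mulN1r. Qed.

Lemma vdotNr n (a c : 'rV[R]_n) : vdot a (- c) = - vdot a c.
Proof. by rewrite vdotC vdotNl vdotC. Qed.

Lemma vdotBl n (a b c : 'rV[R]_n) : vdot (a - b) c = vdot a c - vdot b c.
Proof. by rewrite vdotDl vdotNl. Qed.

Lemma vdotBr n (a b c : 'rV[R]_n) : vdot a (b - c) = vdot a b - vdot a c.
Proof. by rewrite vdotDr vdotNr. Qed.

Lemma vdot0l n (c : 'rV[R]_n) : vdot 0 c = 0.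
Proof. by apply: big1 => i _; rewrite mxE mul0r. Qed.

Lemma vdot_const n (a : 'rV[R]_n) : vdot (const_mx 1) a = \sum_i a 0 i.
Proof. by apply: eq_bigr => i _; rewrite mxE mul1r. Qed.

Lemma vdot_delta n (a : 'rV[R]_n) i : vdot (delta_mx 0 i) a = a 0 i.
Proof.
rewrite /vdot (bigD1 i)//= big1 ?addr0 => [|j ji]; first by rewrite mxE !eqxx mul1r.
by rewrite mxE eqxx (negbTE ji) mul0r.
Qed.

Lemma vdot_norm_le n (a b : 'rV[R]_n) : `|vdot a b| <= n%:R * (`|a| * `|b|).
Proof.
rewrite (le_trans (ler_norm_sum _ _ _))//.
rewrite -[X in X%:R](card_ord n) mulr_natl -sumr_const.
by apply: ler_sum => i _; rewrite normrM ler_pM// norm_coord_le.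
Qed.

Lemma vdot_self_ge0 n (v : 'rV[R]_n) : 0 <= vdot v v.
Proof. by apply: sumr_ge0 => i _; rewrite -expr2 sqr_ge0. Qed.

Lemma vdot_self_gt0 n (v : 'rV[R]_n) : v != 0 -> 0 < vdot v v.
Proof.
move=> v0; rewrite lt_def vdot_self_ge0 andbT; apply: contra v0.
rewrite psumr_eq0 => [/allP v0|i _]; last by rewrite -expr2 sqr_ge0.
apply/eqP/rowP => i; rewrite mxE.
by have := v0 i (mem_index_enum _); rewrite mulf_eq0 orbb => /eqP.
Qed.

Lemma continuous_vdot n (a : 'rV[R]_n) : continuous (vdot a).
Proof.
apply: (@lipschitz_continuous _ _ _ (n%:R * `|a|)) => [|b c].
  by rewrite mulr_ge0.
by rewrite -vdotBr -mulrA vdot_norm_le.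
Qed.

Lemma continuous_row_sum n : continuous (fun v : 'rV[R]_n => \sum_i v 0 i).
Proof.
by rewrite (_ : (fun _ => _) = vdot (const_mx 1));
  [exact: continuous_vdot|apply/funext => v; rewrite vdot_const].
Qed.

Lemma continuous_rsum (T : topologicalType) (I : Type) (r : seq I) (f : I -> T -> R) :
  (forall i, continuous (f i)) -> continuous (fun x => \sum_(i <- r) f i x).
Proof.
move=> cf; elim: r => [|i r IH].
  by under eq_fun do rewrite big_nil; move=> x; exact: cvg_cst.
by under eq_fun do rewrite big_cons; move=> x; apply: cvgD; [exact: cf|exact: IH].
Qed.

Lemma closed_level n (f : 'rV[R]_n -> R) c : continuous f ->
  closed [set v | f v = c].
Proof.
move=> cf; apply: (@preimage_closed _ _ f [set x | x = c]) => [v _|].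
  exact: cf.
exact: closed_eq.
Qed.

Lemma closed_superlevel n (f : 'rV[R]_n -> R) c : continuous f ->
  closed [set v | c <= f v].
Proof.
move=> cf; apply: (@preimage_closed _ _ f [set x | c <= x]) => [v _|].
  exact: cf.
exact: closed_ge.
Qed.

Lemma closed_sublevel n (f : 'rV[R]_n -> R) c : continuous f ->
  closed [set v | f v <= c].
Proof.
move=> cf; apply: (@preimage_closed _ _ f [set x | x <= c]) => [v _|].
  exact: cf.
exact: closed_le.
Qed.

(** Makes pointwise positivity uniform: for the optimality gap on a sphere, and for the increments
    of [F] on a ball. *)
Lemma compact_pos_lbound n (K : set 'rV[R]_n) (f : 'rV[R]_n -> R) :
  closed K -> (exists M, forall v, K v -> `|v| <= M) -> continuous f ->
  (forall v, K v -> 0 < f v) -> exists2 c, 0 < c & forall v, K v -> c <= f v.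
Proof.
move=> cK [M KM] cf f0.
have compK : compact K.
  apply: bounded_closed_compact => //; exists M; split; first exact: num_real.
  by move=> N MN v /KM /le_trans; apply; exact: ltW.
have [->|/set0P[v0 Kv0]] := eqVneq K set0; first by exists 1.
have [c] := EVT_min_rV (ex_intro _ v0 Kv0) compK (continuous_subspaceT cf).
rewrite inE => Kc cmin; exists (f c); first exact: f0.
by move=> v Kv; apply: cmin; rewrite inE.
Qed.

End RowVectors.

(** * Scaling, differences and finite sums under the expectation *)

Section GaussLinear.
Variables (R : realType) (d : nat).
Implicit Types f g : 'rV[R]_d -> R.

Lemma gaussZ a f : gauss_integrable f ->
  gauss_integrable (fun z => a * f z) /\
  gauss_expect (fun z => a * f z) = a * gauss_expect f.
Proof.
move=> fi; have [c1 c2] := gauss_cst d (0 : R).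
have [] := gauss_lin a fi c1; rewrite c2 addr0.
by rewrite (_ : (fun _ => _ + _) = (fun z => a * f z))//; apply/funext => z; rewrite addr0.
Qed.

Lemma gaussD f g : gauss_integrable f -> gauss_integrable g ->
  gauss_integrable (fun z => f z + g z) /\
  gauss_expect (fun z => f z + g z) = gauss_expect f + gauss_expect g.
Proof.
move=> fi gi; have [] := gauss_lin 1 fi gi; rewrite mul1r.
by rewrite (_ : (fun _ => _ + _) = (fun z => f z + g z))//; apply/funext => z; rewrite mul1r.
Qed.

Lemma gaussB f g : gauss_integrable f -> gauss_integrable g ->
  gauss_integrable (fun z => f z - g z) /\
  gauss_expect (fun z => f z - g z) = gauss_expect f - gauss_expect g.
Proof.
move=> fi gi; have [ngi nge] := gaussZ (-1) gi.
have [] := gaussD fi ngi; rewrite nge mulN1r.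
by rewrite (_ : (fun _ => _ + _) = (fun z => f z - g z))//; apply/funext => z; rewrite mulN1r.
Qed.

Lemma gauss_sum (I : Type) (r : seq I) (f : I -> 'rV[R]_d -> R) :
  (forall i, gauss_integrable (f i)) ->
  gauss_integrable (fun z => \sum_(i <- r) f i z) /\
  gauss_expect (fun z => \sum_(i <- r) f i z) = \sum_(i <- r) gauss_expect (f i).
Proof.
move=> fi; elim: r => [|i r [IH1 IH2]].
  rewrite big_nil (_ : (fun _ => _) = fun=> 0); first exact: gauss_cst.
  by apply/funext => z; rewrite big_nil.
have [D1 D2] := gaussD (fi i) IH1.
rewrite big_cons -IH2 -D2 (_ : (fun _ => _) = fun z => f i z + \sum_(j <- r) f j z)//.
by apply/funext => z; rewrite big_cons.
Qed.

End GaussLinear.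

(** * The perturbed maximum: Lipschitz bounds, shifts, convexity, comparison with [vmax] *)

Section PerturbedMax.
Variables (R : realType) (d n : nat) (Y : 'M[R]_(d, n)) (n0 : (0 < n)%N).

Implicit Types (eps t c m : R) (s : 'rV[R]_n) (z : 'rV[R]_d).

Definition payoff (eps : R) (s : 'rV[R]_n) (z : 'rV[R]_d) : 'rV[R]_n :=
  s + eps *: (z *m Y).
Definition pmax (eps : R) s z := vmax (payoff eps s z).

Lemma pmaxE eps s z : pmax eps s z = vmax (payoff eps s z).
Proof. by []. Qed.

Lemma payoffE eps s z i : payoff eps s z 0 i = s 0 i + eps * \sum_k z 0 k * Y k i.
Proof. by rewrite !mxE. Qed.

Lemma payoffD eps s h z : payoff eps (s + h) z = payoff eps s z + h.
Proof. by rewrite /payoff addrAC. Qed.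

Lemma payoff_coordD eps s h z i : payoff eps (s + h) z 0 i = payoff eps s z 0 i + h 0 i.
Proof. by rewrite payoffD mxE. Qed.

Lemma payoff_coord_delta eps s c z i j :
  payoff eps (s + c *: delta_mx 0 i) z 0 j = payoff eps s z 0 j + c * (j == i)%:R.
Proof. by rewrite payoff_coordD !mxE. Qed.

(** Regularity in the noise, from which integrability follows. The constant is crude: the sum of all
    entries dominates each single one. *)
Lemma lipschitz1_pmax eps s :
  lipschitz1 (\sum_i \sum_k `|eps * Y k i|) (pmax eps s).
Proof.
have K0 : 0 <= \sum_i \sum_k `|eps * Y k i| by do 2 apply: sumr_ge0 => ? _.
split=> // y z; apply: vmax_dist => // i; rewrite !payoffE.
rewrite (_ : _ - _ = \sum_k (eps * Y k i) * (y 0 k - z 0 k)); last first.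
  rewrite opprD addrACA subrr add0r -mulrBr -sumrB mulr_sumr.
  by apply: eq_bigr => k _; ring.
rewrite (le_trans (ler_norm_sum _ _ _))// /dist1 mulr_sumr.
apply: ler_sum => k _; rewrite normrM ler_wpM2r//.
rewrite (bigD1 i)//= (bigD1 k)//= -addrA lerDl addr_ge0 ?sumr_ge0// => j _.
exact: sumr_ge0.
Qed.

Lemma gauss_pmax eps s : gauss_integrable (pmax eps s).
Proof. exact: gauss_lipschitz1 (lipschitz1_pmax eps s). Qed.

(** Monotonicity and translation in one comparison; nonexpansiveness for the sup norm and
    equivariance under constant shifts both follow from it. *)
Lemma Feps_le_shift eps s s' m : (forall i, s 0 i <= s' 0 i + m) ->
  Feps Y eps s <= Feps Y eps s' + m.
Proof.
move=> ss'; have [c1 c2] := gauss_cst d m.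
have [D1 D2] := gaussD (gauss_pmax eps s') c1.
rewrite c2 in D2; rewrite -[leRHS]D2; apply: gauss_le => //.
  exact: gauss_pmax.
move=> z; apply: vmax_le_shift => // i; rewrite !payoffE.
by have := ss' i; lra.
Qed.

Lemma Feps_dist eps s s' : `|Feps Y eps s - Feps Y eps s'| <= `|s - s'|.
Proof.
have h (a b : 'rV[R]_n) i : a 0 i <= b 0 i + `|a - b|.
  by rewrite -lerBlDl; have := norm_coord_le (a - b) i; rewrite !mxE ler_norml => /andP[].
rewrite ler_norml; apply/andP; split.
  by rewrite lerBrDr addrC lerBlDr distrC; apply: Feps_le_shift => i; exact: h.
by rewrite lerBlDl; apply: Feps_le_shift => i; exact: h.
Qed.

Lemma continuous_Feps eps : continuous (Feps Y eps).
Proof.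
apply: (@lipschitz_continuous _ _ _ 1) => // s t.
by rewrite mul1r Feps_dist.
Qed.

Lemma Feps_shift eps s c : Feps Y eps (s + c *: const_mx 1) = Feps Y eps s + c.
Proof.
apply/eqP; rewrite eq_le; apply/andP; split.
  by apply: Feps_le_shift => i; rewrite !mxE mulr1.
by rewrite -lerBrDr; apply: Feps_le_shift => i; rewrite !mxE mulr1; lra.
Qed.

Lemma payoff_convex eps s1 s2 t z : payoff eps (t *: s1 + (1 - t) *: s2) z =
  t *: payoff eps s1 z + (1 - t) *: payoff eps s2 z.
Proof. by apply/rowP => i; rewrite !mxE; ring. Qed.

Lemma payoff_coord_convex eps s1 s2 t z i : payoff eps (t *: s1 + (1 - t) *: s2) z 0 i =
  t * payoff eps s1 z 0 i + (1 - t) * payoff eps s2 z 0 i.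
Proof. by rewrite payoff_convex !mxE. Qed.

Lemma pmax_convex eps s1 s2 t z : 0 <= t <= 1 ->
  pmax eps (t *: s1 + (1 - t) *: s2) z <= t * pmax eps s1 z + (1 - t) * pmax eps s2 z.
Proof. by move=> t01; rewrite /pmax payoff_convex vmax_convex. Qed.

Lemma Feps_combination eps s1 s2 t :
  gauss_integrable (fun z => t * pmax eps s1 z + (1 - t) * pmax eps s2 z) /\
  gauss_expect (fun z => t * pmax eps s1 z + (1 - t) * pmax eps s2 z) =
  t * Feps Y eps s1 + (1 - t) * Feps Y eps s2.
Proof.
have [Z1 Z2] := gaussZ (1 - t) (gauss_pmax eps s2).
by have [] := gauss_lin t (gauss_pmax eps s1) Z1; rewrite Z2.
Qed.

Lemma Feps_convex eps s1 s2 t : 0 <= t <= 1 ->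
  Feps Y eps (t *: s1 + (1 - t) *: s2) <= t * Feps Y eps s1 + (1 - t) * Feps Y eps s2.
Proof.
move=> t01; have [C1 <-] := Feps_combination eps s1 s2 t.
apply: gauss_le => // [|z]; [exact: gauss_pmax|exact: pmax_convex].
Qed.

Lemma Feps_le_vmax eps s : Feps Y eps s <= vmax s + Feps Y eps 0.
Proof.
have [c1 c2] := gauss_cst d (vmax s).
have [D1 D2] := gaussD c1 (gauss_pmax eps 0).
rewrite c2 in D2; rewrite -[leRHS]D2; apply: gauss_le => //.
  exact: gauss_pmax.
move=> z; have := vmaxD_le (payoff eps 0 z) s n0.
by rewrite -payoffD add0r [leRHS]addrC.
Qed.

(** Adding the payoff of 0 under the opposite noise cancels the perturbation of [s], and the maximum
    is subadditive. *)
Lemma vmax_le_Feps eps s : vmax s <= Feps Y eps s + Feps Y (- eps) 0.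
Proof.
have [c1 c2] := gauss_cst d (vmax s).
have [D1 D2] := gaussD (gauss_pmax eps s) (gauss_pmax (- eps) 0).
rewrite -[leRHS]D2 -c2; apply: gauss_le => // z.
rewrite /pmax (le_trans _ (vmaxD_le _ _ n0))//.
by rewrite (_ : _ + _ = s)//; apply/rowP => i; rewrite !mxE; ring.
Qed.

End PerturbedMax.

(** * Every column of [Y] is an exposed point of the convex hull *)

Section Vertices.
Variables (R : realType) (d n : nat) (Y : 'M[R]_(d, n)).
Hypothesis injY : injective (fun i : 'I_n => col i Y).
Hypothesis vertexY : forall (i : 'I_n) (lam : 'rV[R]_n),
  (forall j, 0 <= lam 0 j < 1) -> lam 0 i = 0 ->
  \sum_(j < n) lam 0 j = 1 -> col i Y != Y *m lam^T.

Lemma simplex_le1 (q : 'rV[R]_n) i : simplex q -> q 0 i <= 1.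
Proof.
by move=> [q0 <-]; rewrite (bigD1 i)//= lerDl sumr_ge0.
Qed.

Lemma simplex_delta i : simplex (delta_mx 0 i : 'rV[R]_n).
Proof.
split=> [j|]; first by rewrite mxE; case: (_ && _).
by rewrite -vdot_const vdotC vdot_delta mxE.
Qed.

Lemma simplex_convex (p q : 'rV[R]_n) t : simplex p -> simplex q ->
  0 <= t <= 1 -> simplex (t *: p + (1 - t) *: q).
Proof.
move=> [p0 p1] [q0 q1] /andP[t0 t1]; split=> [j|].
  by rewrite !mxE addr_ge0 ?mulr_ge0// subr_ge0.
rewrite -!vdot_const in p1 q1 *.
by rewrite vdotDr !vdotZr p1 q1; ring.
Qed.

Lemma closed_simplex : closed (@simplex R n).
Proof.
rewrite (_ : @simplex R n = \bigcap_i [set q | 0 <= q 0 i] `&`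
    [set q | \sum_i q 0 i = 1]).
  apply: closedI.
    apply: closed_bigI => i _.
    exact: closed_superlevel (@coord_continuous _ _ _ 0 i).
  exact: closed_level (@continuous_row_sum R n).
by apply/seteqP; split=> q [q0 q1]; split=> // i; first move=> _; exact: q0.
Qed.

(** Vector from the hull point with weights [lam] to the vertex [i], transposed to a row. *)
Let defect i (lam : 'rV[R]_n) : 'rV[R]_d := (col i Y)^T - lam *m Y^T.

(** Weights all below 1 are excluded by [vertexY]. A weight equal to 1 makes the hull point another
    column, which is excluded by injectivity. *)
Let defect_neq0 i lam : simplex lam -> lam 0 i = 0 -> defect i lam != 0.
Proof.
move=> slam lami; apply/negP; rewrite subr_eq0 => /eqP h.
have {}h : col i Y = Y *m lam^T by rewrite -[LHS]trmxK h trmx_mul trmxK.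
have [/forallP l1|] := boolP [forall j, lam 0 j < 1].
  have c j : 0 <= lam 0 j < 1 by rewrite slam.1 l1.
  by have := vertexY c lami slam.2; rewrite h eqxx.
rewrite negb_forall => /existsP[j]; rewrite -leNgt => lj.
have lj1 : lam 0 j = 1 by apply/eqP; rewrite eq_le lj simplex_le1.
have lam_j : lam = delta_mx 0 j.
  apply/rowP => k; rewrite mxE eqxx/=; have [->//|kj] := eqVneq k j.
  have := slam.2; rewrite (bigD1 j)//= lj1 -[RHS]addr0 => /addrI/eqP.
  rewrite psumr_eq0 => [/allP/(_ k)|i' _]; last exact: slam.1.
  by rewrite mem_index_enum kj => /(_ isT)/eqP.
have ij : i = j.
  apply: injY; rewrite h lam_j; apply/colP => k; rewrite !mxE.
  rewrite (bigD1 j)//= big1 => [|l lj']; first by rewrite !mxE !eqxx mulr1 addr0.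
  by rewrite !mxE eqxx (negbTE lj') mulr0.
by move: lami; rewrite ij lj1 => /eqP; rewrite oner_eq0.
Qed.

Let defect_sq_continuous i : continuous (fun lam => vdot (defect i lam) (defect i lam)).
Proof.
apply: continuous_rsum => k lam.
have ck : continuous (fun lam => defect i lam 0 k).
  rewrite (_ : (fun _ => _) = fun lam : 'rV[R]_n => Y k i - vdot (row k Y) lam).
    by move=> x; apply: continuousB; [apply: cst_continuous|apply: continuous_vdot].
  apply/funext => x; rewrite !mxE; congr (_ - _).
  by apply: eq_bigr => j _; rewrite !mxE mulrC.
exact: cvgM (ck lam) (ck lam).
Qed.

(* The direction is the difference between the vertex and its projection on the
   convex hull of the other columns. *)
Lemma vertex_exposed i : exists z : 'rV[R]_d,
  forall j, j != i -> (z *m Y) 0 j < (z *m Y) 0 i.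
Proof.
pose K := @simplex R n `&` [set lam | lam 0 i = 0].
have cK : closed K.
  apply: closedI; first exact: closed_simplex.
  exact: closed_level (@coord_continuous _ _ _ 0 i).
have compK : compact K.
  apply: bounded_closed_compact => //; exists 1; split; first exact: num_real.
  move=> N N1 v [sv _]; apply: le_trans (ltW N1).
  by apply: norm_row_le => // j; rewrite ger0_norm ?sv.1// simplex_le1.
(* An empty [K] means that [i] is the only index, and any direction exposes it. *)
have [K0|/set0P[v0 Kv0]] := eqVneq K set0.
  exists 0 => j ji; have : K (delta_mx 0 j).
    by split; [exact: simplex_delta|rewrite /= mxE eq_sym (negbTE ji) andbF].
  by rewrite K0.
have [l] := EVT_min_rV (ex_intro _ v0 Kv0) compK
  (continuous_subspaceT (@defect_sq_continuous i)).
rewrite inE => -[sl li].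
have [p pE] : exists p, p = defect i l by eexists.
rewrite -pE => lmin.
have p0 : p != 0 by rewrite pE; exact: defect_neq0.
have pp : 0 < vdot p p by exact: vdot_self_gt0.
exists p => j ji; pose q := defect i (delta_mx 0 j).
have qE k : q 0 k = Y k i - Y k j.
  rewrite !mxE; congr (_ - _).
  have -> : Y k j = row k Y 0 j by rewrite mxE.
  by rewrite -vdot_delta; apply: eq_bigr => m _; rewrite !mxE.
(* Variational inequality of the projection: it yields [vdot p q >= vdot p p > 0], and [vdot p q] is
   the gap between the values at [i] and at [j]. *)
suff : 0 <= vdot p (q - p).
  rewrite vdotBr subr_ge0 => /(lt_le_trans pp); rewrite -[in X in _ -> X]subr_gt0.
  rewrite (_ : vdot p q = (p *m Y) 0 i - (p *m Y) 0 j)//.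
  rewrite [(p *m Y) 0 i]mxE [(p *m Y) 0 j]mxE -sumrB.
  by apply: eq_bigr => k _; rewrite qE mulrBr.
have Dt t : defect i (t *: delta_mx 0 j + (1 - t) *: l) = p + t *: (q - p).
  rewrite /q pE /defect mulmxDl -!scalemxAl.
  by apply/rowP => k; rewrite !mxE; ring.
move: (q - p) Dt => e Dt.
have Ht t : 0 <= t <= 1 -> 0 <= 2 * t * vdot p e + t ^+ 2 * vdot e e.
  move=> t01; have : vdot p p <= vdot (p + t *: e) (p + t *: e).
    rewrite -Dt; apply: lmin; rewrite inE; split.
      by apply: simplex_convex => //; exact: simplex_delta.
    by rewrite /= !mxE li eq_sym (negbTE ji) andbF !mulr0 addr0.
  rewrite vdotDl !vdotDr !vdotZl !vdotZr (vdotC e p).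
  by set u := vdot p e; set w := vdot e e; rewrite expr2; lra.
rewrite leNgt; apply/negP => a0.
set a := vdot p e in a0 Ht; set b := vdot e e in Ht.
have b0 : 0 <= b by exact: vdot_self_ge0.
(* With [a < 0 <= b] this [t] lies in []0, 1]] and [2 a + t b = a (1 + t)] is negative, against
   minimality of [p] along the segment. *)
pose t := - a / (b - a); have ba : 0 < b - a by lra.
have t0 : 0 < t by rewrite divr_gt0// oppr_gt0.
have tba : t * (b - a) = - a by rewrite divfK// gt_eqF.
have t1 : t <= 1 by rewrite ler_pdivrMr//; lra.
have := Ht t; rewrite (ltW t0) t1 => /(_ isT).
rewrite (_ : _ + _ = t * (2 * a + t * b)); last by ring.
rewrite pmulr_rge0//; have : t * a <= 0 by rewrite pmulr_rle0// ltW.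
nra.
Qed.

Lemma vertex_exposed_margin i (eps M : R) : 0 < eps -> exists z : 'rV[R]_d,
  forall j, j != i -> eps * (z *m Y) 0 j + M < eps * (z *m Y) 0 i.
Proof.
move=> e0; have [z hz] := vertex_exposed i.
pose gap j := (z *m Y) 0 i - (z *m Y) 0 j.
(* The sum of the scalings required by the single competitors dominates each of them, since all are
   nonnegative. *)
pose c := \sum_(j | j != i) (`|M| + 1) / (eps * gap j).
exists (c *: z) => j ji; rewrite -scalemxAl !mxE -ltrBrDl -mulrBr -mulrBr.
have gap_gt0 k : k != i -> 0 < eps * gap k.
  by move=> ki; rewrite mulr_gt0// subr_gt0 hz.
have M1 : 0 <= `|M| + 1 by rewrite addr_ge0.
rewrite (@lt_le_trans _ _ (`|M| + 1))//.
  by rewrite (le_lt_trans (ler_norm _))// ltrDl.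
rewrite (_ : _ - _ = gap j); last by rewrite /gap !mxE.
rewrite mulrCA -ler_pdivrMr ?gap_gt0//.
rewrite /c (bigD1 j)//= lerDl sumr_ge0// => k /andP[ki _].
by rewrite divr_ge0// ltW// gap_gt0.
Qed.

End Vertices.

(** * Strict monotonicity in each coordinate and strict convexity on [Vdelta] *)

Section StrictConvexity.
Variables (R : realType) (d n : nat) (Y : 'M[R]_(d, n)) (eps : R).
Hypotheses (n0 : (0 < n)%N) (eps0 : 0 < eps).
Hypothesis injY : injective (fun i : 'I_n => col i Y).
Hypothesis vertexY : forall (i : 'I_n) (lam : 'rV[R]_n),
  (forall j, 0 <= lam 0 j < 1) -> lam 0 i = 0 ->
  \sum_(j < n) lam 0 j = 1 -> col i Y != Y *m lam^T.

Notation payoff := (payoff Y eps).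
Notation pmax := (pmax Y eps).
Notation F := (Feps Y eps).

Lemma pmaxP s z : (forall i, payoff s z 0 i <= pmax s z) /\
  exists i, pmax s z = payoff s z 0 i.
Proof. exact: vmax_attained. Qed.

(** The margin [M + M + 1] absorbs two coordinates of any [s] in the ball and leaves a gap of 1, so
    one noise serves all these [s]. *)
Lemma isolated_argmax (i : 'I_n) (M : R) : exists z : 'rV[R]_d,
  forall (s : 'rV[R]_n) j, `|s| <= M -> j != i -> payoff s z 0 j + 1 < payoff s z 0 i.
Proof.
have [z hz] := vertex_exposed_margin injY vertexY i (M + M + 1) eps0.
exists z => s j sM ji; have := hz j ji; rewrite /payoff !mxE.
have := norm_coord_le s i; have := norm_coord_le s j.
move=> /le_trans/(_ sM); rewrite ler_norml => /andP[_ h1].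
move=> /le_trans/(_ sM); rewrite ler_norml => /andP[h2 _].
lra.
Qed.

(** The integrands are ordered pointwise; equal expectations would make them equal for every noise,
    including one for which [i] is the only maximizer. *)
Lemma Feps_incr s i : 0 < F s - F (s - delta_mx 0 i).
Proof.
have ge z : 0 <= pmax s z - pmax (s - delta_mx 0 i) z.
  rewrite subr_ge0 -[leRHS]addr0; apply: vmax_le_shift => // j.
  by rewrite !payoffE !mxE addr0 lerD2r gerBl; case: (_ && _).
have [D1 D2] := gaussB (gauss_pmax Y n0 eps s) (gauss_pmax Y n0 eps (s - delta_mx 0 i)).
have FE : gauss_expect (fun z => pmax s z - pmax (s - delta_mx 0 i) z) =
  F s - F (s - delta_mx 0 i) by [].
have F0 : 0 <= F s - F (s - delta_mx 0 i).
  have [c1 c2] := gauss_cst d (0 : R).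
  by rewrite -FE -c2; apply: gauss_le.
rewrite lt_def F0 andbT; apply/eqP => eF.
have L := lipschitz1_lin (-1) (lipschitz1_pmax Y n0 eps (s - delta_mx 0 i))
  (lipschitz1_pmax Y n0 eps s).
have {}L := gauss_expect_eq0 L.
have [z hz] := isolated_argmax i `|s|.
have : -1 * pmax (s - delta_mx 0 i) z + pmax s z = 0.
  apply: L => [y|]; first by rewrite mulN1r addrC.
  rewrite -eF -FE; congr gauss_expect; apply/funext => y.
  by rewrite mulN1r addrC.
have dE : s - delta_mx 0 i = s + (-1) *: delta_mx 0 i by rewrite scaleN1r.
have [le_s _] := pmaxP s z; have [_ [j ->]] := pmaxP (s - delta_mx 0 i) z.
have := le_s i; have [->|ji] := eqVneq j i.
  by rewrite dE payoff_coord_delta eqxx /=; lra.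
have := hz s j (lexx _) ji; rewrite dE payoff_coord_delta (negbTE ji) /=; lra.
Qed.

(** If [h 0] and [h 1] differ, the intermediate value theorem provides [n + 1] distinct values of
    [h], too many for the [n] values allowed. *)
Lemma finite_valued_constant (h : R -> R) (v : 'I_n -> R) : continuous h ->
  (forall u, exists i, h u = v i) -> h 0 = h 1.
Proof.
move=> ch hv; apply/eqP; apply: contraT => h01.
have [idx idxE] := choice hv.
pose t (k : 'I_n.+1) : R := k%:R / n.+1%:R.
have t01 k : 0 <= t k <= 1.
  by rewrite divr_ge0// ler_pdivrMr ?ltr0n// mul1r ler_nat ltnW.
pose y k := h 0 + t k * (h 1 - h 0).
have hit k : exists c, h c = y k.
  have yk : Num.min (h 0) (h 1) <= y k <= Num.max (h 0) (h 1).
    have /andP[t0 t1] := t01 k; rewrite /y.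
    by have [hle|hlt] := leP (h 0) (h 1); apply/andP; split; nra.
  have [c _ hc] := IVT ler01 (continuous_subspaceT ch) yk.
  by exists c.
have [c hc] := choice hit.
have inj_idx : injective (fun k => idx (c k)).
  move=> k l /(congr1 v); rewrite -!idxE !hc /y => /addrI/mulIf.
  rewrite subr_eq0 eq_sym => /(_ h01); rewrite /t => /mulIf.
  rewrite invr_eq0 pnatr_eq0 => /(_ isT)/eqP; rewrite eqr_nat => /eqP.
  exact: val_inj.
by have := leq_card _ inj_idx; rewrite !card_ord ltnn.
Qed.

(** An index attaining the maximum of the combination has payoffs below both maxima; as both weights
    are positive, equality of the combinations forces equality in each. *)
Lemma common_argmax s1 s2 z t : 0 < t < 1 ->
  t * pmax s1 z + (1 - t) * pmax s2 z = pmax (t *: s1 + (1 - t) *: s2) z ->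
  exists i, pmax s1 z = payoff s1 z 0 i /\ pmax s2 z = payoff s2 z 0 i.
Proof.
move=> /andP[t0 t1] e.
have [_ [i hi]] := pmaxP (t *: s1 + (1 - t) *: s2) z; exists i.
have := (pmaxP s1 z).1 i; have := (pmaxP s2 z).1 i.
by move: e; rewrite hi payoff_coord_convex; split; nra.
Qed.

Lemma Feps_strictly_convex s1 s2 t : Vdelta s1 -> Vdelta s2 -> s1 != s2 ->
  0 < t < 1 -> F (t *: s1 + (1 - t) *: s2) < t * F s1 + (1 - t) * F s2.
Proof.
move=> V1 V2 s12 t01; have /andP[t0 t1] := t01.
have t01' : 0 <= t <= 1 by rewrite !ltW.
rewrite lt_neqAle Feps_convex// andbT; apply: contra s12 => /eqP eF.
set s := t *: s1 + (1 - t) *: s2 in eF.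
have [C1 C2] := Feps_combination Y n0 eps s1 s2 t.
have L1 := lipschitz1_lin (1 - t) (lipschitz1_pmax Y n0 eps s2)
  (lipschitz1_cst d (0 : R)).
have L2 := lipschitz1_lin (-1) (lipschitz1_pmax Y n0 eps s)
  (lipschitz1_lin t (lipschitz1_pmax Y n0 eps s1) L1).
(* The convexity gap of the integrand is nonnegative and Lipschitz with zero expectation, so it
   vanishes everywhere. The terms [-1 * _] and [_ + 0] are the shape given by [lipschitz1_lin]. *)
have gap0 z : t * pmax s1 z + (1 - t) * pmax s2 z = pmax s z.
  have := gauss_expect_eq0 L2 _ _ z.
  have gE : (fun z => -1 * pmax s z +
      (t * pmax s1 z + ((1 - t) * pmax s2 z + 0))) =
    (fun z => t * pmax s1 z + (1 - t) * pmax s2 z - pmax s z).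
    by apply/funext => y; ring.
  rewrite gE (gaussB C1 (gauss_pmax Y n0 eps s)).2 C2 -eF subrr.
  move=> h; suff : -1 * pmax s z + (t * pmax s1 z + ((1 - t) * pmax s2 z + 0)) = 0 by lra.
  apply: h => // y; have := pmax_convex Y n0 eps s1 s2 y t01'; rewrite -/s; lra.
have comm z := common_argmax t01 (gap0 z).
pose g z := pmax s1 z - pmax s2 z.
have gv z : exists i, g z = s1 0 i - s2 0 i.
  have [i [e1 e2]] := comm z; exists i.
  by rewrite /g e1 e2 !payoffE; ring.
have Lg := lipschitz1_lin (-1) (lipschitz1_pmax Y n0 eps s2) (lipschitz1_pmax Y n0 eps s1).
(* Along the segment from [y] to [z], [g] is continuous with values among the differences
   [s1 0 i - s2 0 i]. *)
have cst_g y z : g y = g z.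
  pose h (u : R) := g (y + u *: (z - y)).
  have -> : g y = h 0 by rewrite /h scale0r addr0.
  have -> : g z = h 1 by rewrite /h scale1r addrC subrK.
  apply: (@finite_valued_constant _ (fun i => s1 0 i - s2 0 i)); last first.
    by move=> u; exact: gv.
  move: Lg; set K := (X in lipschitz1 X _) => -[k0 kg].
  apply: (@lipschitz_continuous _ R^o _ (K * dist1 z y)); last first.
    move=> a b; have := kg (y + a *: (z - y)) (y + b *: (z - y)).
    rewrite !mulN1r ![- _ + _]addrC => /le_trans->//.
    rewrite -mulrA ler_wpM2l// /dist1 mulr_suml; apply: ler_sum => i _.
    by rewrite !mxE -normrM (_ : _ - _ = (z 0 i - y 0 i) * (a - b))//; ring.
  by rewrite mulr_ge0// dist1_ge0.
(* A noise that isolates [k] forces the common maximizer to be [k], so the constant value of [g] is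
   the difference at every [k]. *)
have diff_cst i j : s1 0 i - s2 0 i = s1 0 j - s2 0 j.
  have at_vertex k : exists z, g z = s1 0 k - s2 0 k.
    have [z hz] := isolated_argmax k `|s1|; exists z.
    have [l [e1 e2]] := comm z; suff -> : k = l by rewrite /g e1 e2 !payoffE; ring.
    apply/eqP; rewrite eq_sym; apply: contraT => lk.
    have := hz s1 l (lexx _) lk; have := (pmaxP s1 z).1 k; lra.
  by have [y <-] := at_vertex i; have [z <-] := at_vertex j.
have [i0] : exists i0 : 'I_n, True by exists (Ordinal n0).
move=> _; have : \sum_i (s1 0 i - s2 0 i) = 0.
  by rewrite sumrB; move: V1 V2; rewrite /Vdelta/= => -> ->; rewrite subr0.
rewrite (eq_bigr (fun=> s1 0 i0 - s2 0 i0)); last by move=> i _; exact: diff_cst.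
rewrite sumr_const card_ord => /eqP; rewrite mulrn_eq0 -[n == 0%N]negbK -lt0n n0/=.
rewrite subr_eq0 => /eqP e0; apply/eqP/rowP => i.
by apply/eqP; rewrite -subr_eq0 (diff_cst i i0) e0 subrr.
Qed.

End StrictConvexity.

(** * One-sided partial derivatives of the maximum *)

Section DirectionalDerivatives.
Variables (R : realType) (n : nat).
Hypothesis n0 : (0 < n)%N.
Implicit Types v : 'rV[R]_n.

Definition isolated v i := [forall j, (j != i) ==> (v 0 j < v 0 i)].

Lemma isolatedP v i : reflect (forall j, j != i -> v 0 j < v 0 i) (isolated v i).
Proof. by apply: (iffP forallP) => h j; [exact/implyP|exact/implyP/h]. Qed.

Lemma vmax_eq v m : (forall i, v 0 i <= m) -> (exists i, v 0 i = m) -> vmax v = m.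
Proof.
move=> vm [i vi]; have [ge_v [j vj]] := vmax_attained v n0.
by apply/eqP; rewrite eq_le {1}vj vm -vi ge_v.
Qed.

Lemma isolated_vmax v i : isolated v i -> vmax v = v 0 i.
Proof.
move=> /isolatedP vi; apply: vmax_eq; last by exists i.
by move=> j; have [->//|/vi/ltW] := eqVneq j i.
Qed.

Lemma coord_delta v c i j : (v + c *: delta_mx 0 i) 0 j = v 0 j + c * (j == i)%:R.
Proof. by rewrite !mxE. Qed.

Lemma vmax_right v i : exists2 c0, 0 < c0 & forall c, 0 < c <= c0 ->
  vmax (v + c *: delta_mx 0 i) = vmax v + c * (v 0 i == vmax v)%:R.
Proof.
have [ge_v [k vk]] := vmax_attained v n0.
have [vi|vi] := eqVneq (v 0 i) (vmax v).
  exists 1 => // c /andP[c0 _]; rewrite mulr1; apply: vmax_eq.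
    move=> j; rewrite coord_delta lerD// ler_piMr//; first exact: ltW.
    by case: (j == i).
  by exists i; rewrite coord_delta eqxx mulr1 vi.
exists (vmax v - v 0 i); first by rewrite subr_gt0 lt_neqAle vi ge_v.
move=> c /andP[c0 c1]; rewrite mulr0 addr0; apply: vmax_eq.
  move=> j; rewrite coord_delta; have [->|_] := eqVneq j i.
    by rewrite mulr1; lra.
  by rewrite mulr0 addr0.
exists k; rewrite coord_delta; have [ki|_] := eqVneq k i.
  by move: vi; rewrite -ki -vk eqxx.
by rewrite mulr0 addr0.
Qed.

(** Lowering a coordinate lowers the maximum only if no other index attains it. The left and right
    derivatives thus differ exactly when [i] maximizes together with another index. *)
Lemma vmax_left v i : exists2 c0, 0 < c0 & forall c, 0 < c <= c0 ->
  vmax (v + c *: - delta_mx 0 i) = vmax v + c * - (isolated v i)%:R.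
Proof.
have [vi|vi] := boolP (isolated v i).
  set w := v + (- 1) *: delta_mx 0 i.
  have [ge_w [k wk]] := vmax_attained w n0.
  have vmi := isolated_vmax vi; move/isolatedP: vi => vi.
  (* [vmax w] bounds all entries other than [i], so [i] remains a maximizer until its entry has
     dropped by this amount. *)
  exists (vmax v - vmax w).
    rewrite subr_gt0 wk coord_delta vmi; have [->|ki] := eqVneq k i.
      by rewrite mulr1; lra.
    by rewrite mulr0 addr0 vi.
  move=> c /andP[c0 c1]; rewrite mulrN1 scalerN -scaleNr; apply: vmax_eq.
    move=> j; rewrite coord_delta; have [->|ji] := eqVneq j i.
      by rewrite mulr1 vmi.
    by have := ge_w j; rewrite coord_delta (negbTE ji) !mulr0; lra.
  by exists i; rewrite coord_delta eqxx mulr1 vmi.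
exists 1 => // c /andP[c0 _]; rewrite oppr0 mulr0 addr0 scalerN -scaleNr.
have [ge_v [k vk]] := vmax_attained v n0.
have [j ji vj] : exists2 j, j != i & v 0 j = vmax v.
  have [ki|ki] := eqVneq k i; last by exists k.
  move: vi; rewrite negb_forall => /existsP[j]; rewrite negb_imply => /andP[ji].
  by rewrite -leNgt => vj; exists j => //; apply: le_anti; rewrite ge_v vk ki.
apply: vmax_eq; last by exists j; rewrite coord_delta (negbTE ji) mulr0 addr0.
move=> l; rewrite coord_delta (le_trans _ (ge_v l))// gerDl mulNr oppr_le0.
by rewrite mulr_ge0// ltW.
Qed.

End DirectionalDerivatives.

(** * One-sided derivatives of [F] and null ties *)

Section Gradient.
Variables (R : realType) (d n : nat) (Y : 'M[R]_(d, n)) (eps : R).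
Hypotheses (n0 : (0 < n)%N) (eps0 : 0 < eps).
Hypothesis injY : injective (fun i : 'I_n => col i Y).

Notation payoff := (payoff Y eps).
Notation pmax := (pmax Y eps).
Notation F := (Feps Y eps).

(* [b] is the one-sided derivative of [vmax] in the direction [h]; convexity
   turns the limit of the difference quotients into an upper bound. *)
Lemma Feps_one_sided (h : 'rV[R]_n) (b : 'rV[R]_n -> R) s :
  (forall i, `|h 0 i| <= 1) ->
  (forall v, exists2 c0, 0 < c0 & forall c, 0 < c <= c0 ->
    vmax (v + c *: h) = vmax v + c * b v) ->
  let p := gauss_expect (fun z => b (payoff s z)) in
  gauss_integrable (fun z => b (payoff s z)) /\
  forall e, 0 < e -> exists2 r, 0 < r & forall c, 0 <= c <= r ->
    F (s + c *: h) - F s - c * p <= e * c.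
Proof.
move=> h1 hb p.
(* Difference quotients with step [1 / (k + 1)]: bounded by 1, and for each noise eventually equal
   to [b]. *)
pose f (k : nat) z := k.+1%:R * (pmax (s + k.+1%:R^-1 *: h) z - pmax s z).
have fE k : gauss_integrable (f k) /\
    gauss_expect (f k) = k.+1%:R * (F (s + k.+1%:R^-1 *: h) - F s).
  have [D1 D2] := gaussB (gauss_pmax Y n0 eps (s + k.+1%:R^-1 *: h)) (gauss_pmax Y n0 eps s).
  by have [Z1 Z2] := gaussZ k.+1%:R D1; rewrite D2 in Z2.
have [c1 c2] := gauss_cst d (1 : R).
have [||Ib Eb] := gauss_dominated (fun k => (fE k).1) c1 _ _ (g := fun z => b (payoff s z)).
- move=> k z; rewrite normrM ger0_norm// -ler_pdivlMl// mulr1.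
  apply: vmax_dist => // i; rewrite payoff_coordD addrAC subrr add0r mxE normrM.
  by rewrite ger0_norm// ler_piMr.
- move=> z; have [c0 c00 hc] := hb (payoff s z).
  apply: cvg_near_cst; near=> k.
  rewrite /f !pmaxE payoffD hc; last first.
    apply/andP; split; first by rewrite invr_gt0.
    by apply: ltW; near: k; exact: (near_infty_natSinv_lt (PosNum c00)).
  by rewrite addrAC subrr add0r mulrA divff ?mul1r.
split=> // e e0.
have /cvgrPdist_le/(_ _ e0)[k _ /(_ k (leqnn _))] := Eb.
rewrite /= (fE k).2 distrC => /(le_trans (ler_norm _)).
set r := k.+1%:R^-1; set q := F (s + r *: h) => hk.
have r0 : 0 < r by rewrite invr_gt0.
exists r => // c /andP[c0 cr].
(* [s + c *: h] is the combination of [s + r *: h] and [s] with weight [l = c / r]. *)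
pose l := c * k.+1%:R.
have l01 : 0 <= l <= 1 by rewrite mulr_ge0//= -ler_pdivlMr// mul1r.
have -> : s + c *: h = l *: (s + r *: h) + (1 - l) *: s.
  rewrite scalerDr scalerA -mulrA divff ?mulr1//.
  by rewrite scalerBl scale1r [RHS]addrAC addrCA addrN addr0.
rewrite -lerBrDr opprK lerBlDr (le_trans (Feps_convex Y n0 eps _ _ l01))//.
rewrite -/q; have : c * (k.+1%:R * (q - F s) - p) <= c * e by rewrite ler_wpM2l.
rewrite /l; lra.
Unshelve. all: by end_near.
Qed.

Definition argmax_prob s i := gauss_expect (fun z => (payoff s z 0 i == pmax s z)%:R).

(** The tie is a hyperplane of noises whose normal, [eps] times a difference of two columns, is
    nonzero by injectivity. *)
Lemma gauss_tie s (i j : 'I_n) : i != j ->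
  gauss_integrable (fun z => (payoff s z 0 i == payoff s z 0 j)%:R : R) /\
  gauss_expect (fun z => (payoff s z 0 i == payoff s z 0 j)%:R : R) = 0.
Proof.
move=> ij; pose w : 'rV[R]_d := eps *: (col i Y - col j Y)^T.
have w0 : w != 0.
  rewrite scaler_eq0 gt_eqF//= trmx_eq0 subr_eq0; apply: contra ij => /eqP/injY.
  by move=> /eqP.
have := gauss_hyperplane (s 0 i - s 0 j) w0.
rewrite (_ : (fun z => (_ + _ == 0)%:R) =
  (fun z => (payoff s z 0 i == payoff s z 0 j)%:R))//.
apply/funext => z; rewrite -[payoff _ _ 0 i == _]subr_eq0 !payoffE.
congr ((_ == _)%:R); rewrite opprD [RHS]addrACA -mulrBr -sumrB; congr (_ + _).
rewrite vdotZl; congr (_ * _); apply: eq_bigr => k _; rewrite !mxE; ring.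
Qed.

(** The two indicators come from the right and left derivatives, which supplies their integrability
    as limits of difference quotients. They differ only at a tie of [i] with another index, and
    there are finitely many such null sets. *)
Lemma argmax_prob_isolated s i :
  [/\ gauss_integrable (fun z => (payoff s z 0 i == pmax s z)%:R : R),
      gauss_integrable (fun z => (isolated (payoff s z) i)%:R : R) &
      gauss_expect (fun z => (isolated (payoff s z) i)%:R) = argmax_prob s i].
Proof.
have d1 j : `|(delta_mx 0 i : 'rV[R]_n) 0 j| <= 1.
  by rewrite mxE normr_nat lern1; case: (_ && _).
have [I1 _] := Feps_one_sided (b := fun v => (v 0 i == vmax v)%:R) s d1
  (fun v => vmax_right n0 v i).
have dN1 j : `|(- delta_mx 0 i : 'rV[R]_n) 0 j| <= 1 by rewrite mxE normrN.
have [I2 _] := Feps_one_sided (b := fun v => - (isolated v i)%:R) s dN1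
  (fun v => vmax_left n0 v i).
have [] := gaussZ (-1) I2; rewrite (_ : (fun _ => -1 * _) =
  (fun z => (isolated (payoff s z) i)%:R)); last by apply/funext => z; rewrite mulN1r opprK.
move=> {I2} I2 _; split=> //; apply/eqP; rewrite eq_le; apply/andP; split.
  apply: gauss_le => // z; rewrite ler_nat; have [iso|//] := boolP (isolated _ _).
  by rewrite pmaxE (isolated_vmax n0 iso) eqxx.
pose tie j z : R := if j == i then 0 else (payoff s z 0 i == payoff s z 0 j)%:R.
have tieE j : gauss_integrable (tie j) /\ gauss_expect (tie j) = 0.
  rewrite /tie; have [_|ji] := eqVneq j i; first exact: gauss_cst.
  by apply: gauss_tie; rewrite eq_sym.
have [S1 S2] := gauss_sum (index_enum 'I_n) (fun j => (tieE j).1).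
have [T1 T2] := gaussD I2 S1.
rewrite (eq_bigr (fun=> 0)) ?big1_eq ?addr0 in S2 *; last by move=> j _; exact: (tieE j).2.
rewrite S2 addr0 in T2; rewrite -T2; apply: gauss_le => // z.
have tie0 j : 0 <= tie j z by rewrite /tie; case: ifP.
have [iso|] := boolP (isolated _ _).
  by rewrite (@le_trans _ _ 1)// ?lern1 ?leq_b1// lerDl sumr_ge0.
rewrite negb_forall => /existsP[j]; rewrite negb_imply => /andP[ji].
rewrite -leNgt add0r => ij; have [iE|_] := eqVneq _ _; last exact: sumr_ge0.
have tij : tie j z = 1.
  rewrite /tie (negbTE ji); suff -> : payoff s z 0 i = payoff s z 0 j by rewrite eqxx.
  by apply: le_anti; rewrite ij iE (vmax_attained _ n0).1.
by rewrite (bigD1 j)//= tij lerDl sumr_ge0.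
Qed.

End Gradient.

(** * Maximizers of a linear form over the simplex *)

Section Argmax.
Variables (R : realType) (n : nat).
Hypothesis n0 : (0 < n)%N.
Implicit Types v q : 'rV[R]_n.

Lemma vdot_simplex_le v q : simplex q -> vdot v q <= vmax v.
Proof.
move=> [q0 q1]; have [ge_v _] := vmax_attained v n0.
rewrite -[leRHS]mulr1 -q1 mulr_sumr; apply: ler_sum => i _.
by rewrite ler_wpM2r.
Qed.

Lemma argmax_simplex_delta v i : v 0 i = vmax v -> argmax_simplex v (delta_mx 0 i).
Proof.
move=> vi; split; first exact: simplex_delta.
by move=> q sq; rewrite [leRHS]vdotC vdot_delta vi vdot_simplex_le.
Qed.

(** Optimality of [q] bounds the sum of the nonnegative terms [(v 0 i - v 0 j) * q 0 j] by 0, so [q]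
    has no mass off [i]. *)
Lemma argmax_simplex_isolated v i : isolated v i -> argmax_simplex v = [set delta_mx 0 i].
Proof.
move=> iso; have vi := isolated_vmax n0 iso; have {}iso := isolatedP v i iso.
apply/seteqP; split=> [q [[q0 q1] qmax]|_ ->]; last exact: argmax_simplex_delta.
have := qmax _ (simplex_delta R i); rewrite vdotC vdot_delta -subr_le0.
rewrite -[v 0 i]mulr1 -q1 mulr_sumr -sumrB => sum_le0.
have t0 j : 0 <= v 0 i * q 0 j - v 0 j * q 0 j.
  rewrite -mulrBl mulr_ge0// subr_ge0; have [->//|/iso/ltW//] := eqVneq j i.
have sum0 : \sum_j (v 0 i * q 0 j - v 0 j * q 0 j) = 0.
  by apply: le_anti; rewrite sum_le0 sumr_ge0.
have qj j : j != i -> q 0 j = 0.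
  move=> ji; move/eqP: sum0; rewrite psumr_eq0// => /allP/(_ j (mem_index_enum _)).
  by rewrite -mulrBl mulf_eq0 subr_eq0 gt_eqF ?iso//= => /eqP.
apply/rowP => j; rewrite mxE eqxx/=; have [->|ji] := eqVneq j i; last exact: qj.
by move: q1; rewrite (bigD1 i)//= big1 ?addr0.
Qed.

(* At a tie [vmax_row v] has several entries equal to 1, so it lies outside the
   simplex and [argmax_simplex v] differs from [[set vmax_row v]]. *)
Definition vmax_row v : 'rV[R]_n := \row_i (v 0 i == vmax v)%:R.

(** At most one index is isolated, so the sum is 0 or 1; when it is 0, two distinct vertices are
    maximizers. The uniqueness event is thereby written with indicators known to be integrable. *)
Lemma argmax_simplex_singleton v :
  (\sum_i (isolated v i)%:R : R) = (argmax_simplex v == [set vmax_row v])%:R.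
Proof.
have [/existsP[i iso]|noniso] := boolP [exists i, isolated v i].
  have vi := isolated_vmax n0 iso.
  have iso_lt := isolatedP v i iso.
  rewrite (bigD1 i)//= iso big1 ?addr0 => [|j ji]; last first.
    have [isoj|//] := boolP (isolated v j).
    have := isolatedP v j isoj i; rewrite eq_sym => /(_ ji).
    by rewrite ltNge (ltW (iso_lt _ ji)).
  rewrite (argmax_simplex_isolated iso) (_ : vmax_row v = delta_mx 0 i) ?eqxx//.
  apply/rowP => j; rewrite !mxE eqxx vi/=; have [->|ji] := eqVneq j i.
    by rewrite eqxx.
  by rewrite lt_eqF// iso_lt.
rewrite big1 => [|i _]; last first.
  by move: noniso; rewrite negb_exists => /forallP/(_ i)/negbTE ->.
have [ge_v [k vk]] := vmax_attained v n0.
have : ~~ isolated v k by move: noniso; rewrite negb_exists => /forallP/(_ k).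
rewrite negb_forall => /existsP[j]; rewrite negb_imply => /andP[jk].
rewrite -leNgt -vk => vj; have {}vj : v 0 j = vmax v by apply: le_anti; rewrite ge_v.
have [e|//] := eqVneq (argmax_simplex v) _.
have := argmax_simplex_delta (esym vk); have := argmax_simplex_delta vj.
rewrite e /= => <- /rowP/(_ j)/eqP.
by rewrite !mxE !eqxx (negbTE jk) eq_sym oner_eq0.
Qed.

End Argmax.

(** * Almost sure uniqueness of the maximizer and differentiability of [F] *)

Section GradientFormula.
Variables (R : realType) (d n : nat) (Y : 'M[R]_(d, n)) (eps : R).
Hypotheses (n0 : (0 < n)%N) (eps0 : 0 < eps).
Hypothesis injY : injective (fun i : 'I_n => col i Y).

Notation payoff := (payoff Y eps).
Notation pmax := (pmax Y eps).
Notation F := (Feps Y eps).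
Notation argmax_prob := (argmax_prob Y eps).
Notation gradF s := (\row_i argmax_prob s i).

(** The probabilities of isolation equal those of maximizing, and the latter sum to at least 1
    because some index always maximizes. *)
Lemma gauss_prob_tie s : gauss_prob
  [set z | argmax_simplex (payoff s z) <> [set vmax_row (payoff s z)]] = 0.
Proof.
have Ii i := argmax_prob_isolated n0 eps0 injY s i.
have I1 i : gauss_integrable (fun z => (isolated (payoff s z) i)%:R : R).
  by have [] := Ii i.
have [S1 S2] := gauss_sum (index_enum 'I_n) I1.
have [c1 c2] := gauss_cst d (1 : R).
have [B1 B2] := gaussB c1 S1.
have nullE z : \1_[set z | argmax_simplex (payoff s z) <>
    [set vmax_row (payoff s z)]] z = 1 - \sum_i (isolated (payoff s z) i)%:R :> R.
  rewrite argmax_simplex_singleton// indicE; case: eqVneq => [e|/eqP e].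
    by rewrite subrr memNset//; move=> /(_ e).
  by rewrite subr0 mem_set.
rewrite /gauss_prob (_ : (fun z => _) = fun z => 1 - \sum_i (isolated (payoff s z) i)%:R).
  apply: le_anti; apply/andP; split; last first.
    have [z1 z2] := gauss_cst d (0 : R); rewrite -[leLHS]z2; apply: gauss_le => // z.
    by rewrite argmax_simplex_singleton// subr_ge0 lern1 leq_b1.
  rewrite B2 c2 S2 subr_le0 (eq_bigr (argmax_prob s)); last first.
    by move=> i _; have [] := Ii i.
  have J1 i : gauss_integrable (fun z => (payoff s z 0 i == pmax s z)%:R : R).
    by have [] := Ii i.
  have [T1 T2] := gauss_sum (index_enum 'I_n) J1.
  rewrite -T2 -[leLHS]c2; apply: gauss_le => // z.
  have [_ [i ei]] := vmax_attained (payoff s z) n0.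
  by rewrite (bigD1 i)//= pmaxE ei eqxx lerDl sumr_ge0.
by apply/funext.
Qed.

Lemma Feps_partial s i e : 0 < e -> exists2 r, 0 < r & forall c, `|c| <= r ->
  F (s + c *: delta_mx 0 i) - F s - c * argmax_prob s i <= e * `|c|.
Proof.
move=> e0.
have d1 j : `|(delta_mx 0 i : 'rV[R]_n) 0 j| <= 1.
  by rewrite mxE normr_nat lern1; case: (_ && _).
have [_ /(_ _ e0)[r r0 hr]] := Feps_one_sided Y eps n0 (b := fun v => (v 0 i == vmax v)%:R) s d1
  (fun v => vmax_right n0 v i).
have dN1 j : `|(- delta_mx 0 i : 'rV[R]_n) 0 j| <= 1 by rewrite mxE normrN.
have [_ /(_ _ e0)[l l0 hl]] := Feps_one_sided Y eps n0 (b := fun v => - (isolated v i)%:R) s dN1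
  (fun v => vmax_left n0 v i).
have [_ I2 I3] := argmax_prob_isolated n0 eps0 injY s i.
have IN : gauss_expect (fun z => - (isolated (payoff s z) i)%:R) = - argmax_prob s i.
  have [_] := gaussZ (-1) I2; rewrite I3 mulN1r => <-; congr gauss_expect.
  by apply/funext => z; rewrite mulN1r.
exists (Num.min r l); first by rewrite lt_min r0.
move=> c; rewrite le_min => /andP[cr cl].
have [c0|c0] := leP 0 c.
  by rewrite ger0_norm// in cr *; apply: hr; rewrite c0.
rewrite ltr0_norm// in cl *.
have := hl (- c); rewrite scalerN scaleNr opprK IN mulrN mulNr opprK; apply.
by rewrite cl oppr_ge0 ltW.
Qed.

(** For the upper bound, [s + h] is the average of the [n] points [s + (n h_i) e_i], each controlled
    by a partial derivative with error [e / n]. *)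
Lemma Feps_gradient s e : 0 < e -> exists2 r, 0 < r & forall h, `|h| <= r ->
  `|F (s + h) - F s - vdot h (gradF s)| <= e * `|h|.
Proof.
move=> e0; have nR : 0 < n%:R :> R by rewrite ltr0n.
have en : 0 < e / n%:R by rewrite divr_gt0.
have : forall i, exists r, 0 < r /\ forall c, `|c| <= r ->
    F (s + c *: delta_mx 0 i) - F s - c * argmax_prob s i <= e / n%:R * `|c|.
  by move=> i; have [r r0 hr] := Feps_partial s i en; exists r.
move=> /choice[rr hrr]; pose r := \big[Num.min/1]_i (rr i / n%:R).
have r0 : 0 < r by apply: lt_bigmin => // i _; rewrite divr_gt0// (hrr i).1.
pose D h := F (s + h) - F s - vdot h (gradF s).
have upper h : `|h| <= r -> D h <= e * `|h|.
  move=> hr.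
  have [S1 S2] := gauss_sum (index_enum 'I_n)
    (fun i => gauss_pmax Y n0 eps (s + (n%:R * h 0 i) *: delta_mx 0 i)).
  have [Z1 Z2] := gaussZ n%:R^-1 S1.
  have FE : F (s + h) <= n%:R^-1 * \sum_i F (s + (n%:R * h 0 i) *: delta_mx 0 i).
    rewrite -S2 -Z2; apply: gauss_le => // [|z]; first exact: gauss_pmax.
    have [_ [j ej]] := vmax_attained (payoff (s + h) z) n0.
    rewrite [leLHS]ej payoff_coordD ler_pdivlMl//.
    have -> : n%:R * (payoff s z 0 j + h 0 j) =
        \sum_i payoff (s + (n%:R * h 0 i) *: delta_mx 0 i) z 0 j.
      rewrite (eq_bigr (fun i => payoff s z 0 j + (n%:R * h 0 i) * (j == i)%:R)).
        rewrite big_split/= sumr_const card_ord mulrDr mulr_natl; congr (_ + _).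
        rewrite (bigD1 j)//= eqxx mulr1 big1 ?addr0// => i ij.
        by rewrite eq_sym (negbTE ij) mulr0.
      by move=> i _; rewrite payoff_coord_delta.
    by apply: ler_sum => i _; rewrite (vmax_attained _ n0).1.
  have Fi i : F (s + (n%:R * h 0 i) *: delta_mx 0 i) <=
      F s + n%:R * h 0 i * argmax_prob s i + e * `|h|.
    have := (hrr i).2 (n%:R * h 0 i); rewrite normrM ger0_norm//.
    have hir : n%:R * `|h 0 i| <= rr i.
      rewrite mulrC -ler_pdivlMr// (le_trans (norm_coord_le _ _))// (le_trans hr)//.
      exact: bigmin_le.
    move=> /(_ hir); rewrite mulrA divfK ?gt_eqF//.
    have : e * `|h 0 i| <= e * `|h| by rewrite ler_pM2l// norm_coord_le.
    lra.
  have : F (s + h) <= F s + vdot h (gradF s) + e * `|h|.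
    rewrite (le_trans FE)// ler_pdivrMl// (le_trans (ler_sum _ (fun i _ => Fi i)))//.
    rewrite !big_split/= !sumr_const card_ord -[F s *+ n]mulr_natl -[(e * _) *+ n]mulr_natl.
    rewrite (eq_bigr (fun i => n%:R * (h 0 i * gradF s 0 i))) => [|i _].
      by rewrite -mulr_sumr -!mulrDr.
    by rewrite mxE mulrA.
  by rewrite /D; lra.
exists r => // h hr; rewrite -/(D h) ler_norml upper// andbT.
(* Midpoint convexity gives [D h + D (- h) >= 0], so the upper bound at [- h] is the lower bound at
   [h]. *)
have := upper (- h); rewrite normrN => /(_ hr).
have half : 0 <= (2^-1 : R) <= 1 by rewrite invr_ge0 invf_le1 ?ler1n ?ler0n ?ltr0n.
have := Feps_convex Y n0 eps (s + h) (s - h) half.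
have -> : 2^-1 *: (s + h) + (1 - 2^-1) *: (s - h) = s.
  by apply/rowP => i; rewrite !mxE; field.
by rewrite /D vdotNl; set u := F (s + h); set w := F (s - h); lra.
Qed.

Lemma Feps_differentiable s :
  differentiable F s /\ forall h, 'd F s h = vdot h (gradF s).
Proof.
pose df h := vdot h (gradF s).
have lin_df : linear df by move=> a x y; rewrite /df vdotDl vdotZl.
pose dfl : {linear 'rV[R]_n -> R^o} := HB.pack df (GRing.isLinear.Build _ _ _ _ df lin_df).
have cdf : continuous dfl.
  rewrite (_ : (dfl : _ -> _) = vdot (gradF s)); first exact: continuous_vdot.
  by apply/funext => h; rewrite vdotC.
have exp_df : F \o shift s = cst (F s) + (dfl : 'rV[R]_n -> R^o) +o_ (0 : 'rV[R]_n) id.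
  apply/eqaddoP => e e0.
  have [r r0 hr] := Feps_gradient s e0.
  apply/nbhs_ballP; exists r => //= h; rewrite -ball_normE /= sub0r normrN => /ltW rh.
  have -> : (F \o shift s - (cst (F s) + (dfl : 'rV[R]_n -> R^o))) h =
      F (s + h) - F s - vdot h (gradF s).
    by rewrite [s + h]addrC -addrA -opprD.
  exact: hr.
have dE := @diff_unique _ _ _ F dfl s cdf exp_df.
split=> [|h]; last by rewrite dE.
by apply/diff_locallyP; rewrite dE.
Qed.

End GradientFormula.

(** * The Fenchel conjugate: domain, attainment, gradient, Legendre type *)

Section Conjugate.
Variables (R : realType) (d n : nat) (Y : 'M[R]_(d, n)) (eps : R).
Hypotheses (n0 : (0 < n)%N) (eps0 : 0 < eps).
Hypothesis injY : injective (fun i : 'I_n => col i Y).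
Hypothesis vertexY : forall (i : 'I_n) (lam : 'rV[R]_n),
  (forall j, 0 <= lam 0 j < 1) -> lam 0 i = 0 ->
  \sum_(j < n) lam 0 j = 1 -> col i Y != Y *m lam^T.

Notation F := (Feps Y eps).
Notation Om := (fenchel F).
Implicit Types s x q h : 'rV[R]_n.

(** Equivalently, [x] is a subgradient of [F] at [s]. *)
Definition fenchel_opt s x := forall s', vdot s' x - F s' <= vdot s x - F s.

Lemma fenchel_ge s q : ((vdot s q - F s)%:E <= Om q)%E.
Proof. by apply: ereal_sup_ubound; exists s. Qed.

Lemma fenchel_le q M : (forall s, vdot s q - F s <= M) -> (Om q <= M%:E)%E.
Proof. by move=> h; apply: ge_ereal_sup => _ [s _ <-]; rewrite lee_fin. Qed.

Lemma fenchel_fin_num q : (Om q < +oo)%E -> Om q \is a fin_num.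
Proof.
move=> qoo; rewrite fin_real// qoo andbT.
exact: lt_le_trans (ltNyr _) (fenchel_ge 0 q).
Qed.

Lemma fenchel_optE s x : fenchel_opt s x -> Om x = (vdot s x - F s)%:E.
Proof. by move=> so; apply: le_anti; rewrite fenchel_le//= fenchel_ge. Qed.

Lemma vdot_shift s x c : \sum_i x 0 i = 1 ->
  vdot (s + c *: const_mx 1) x = vdot s x + c.
Proof. by move=> x1; rewrite vdotDl vdotZl vdot_const x1 mulr1. Qed.

Lemma proj_V_Vdelta s : Vdelta (proj_V s).
Proof.
rewrite /Vdelta/= -vdot_const vdotBr vdotZr !vdot_const.
under [X in _ / _ * X]eq_bigr do rewrite mxE.
by rewrite sumr_const card_ord -[1 *+ n]/(n%:R) divfK ?subrr// pnatr_eq0 -lt0n.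
Qed.

Lemma proj_decomp s : s = proj_V s + ((\sum_(i < n) s 0 i) / n%:R) *: const_mx 1.
Proof. by rewrite /proj_V /proj_perp subrK. Qed.

(** A constant shift of [s] changes both terms by the same amount, so the supremum may be taken over
    [Vdelta]. *)
Lemma fenchel_obj_proj s x : \sum_i x 0 i = 1 ->
  vdot s x - F s = vdot (proj_V s) x - F (proj_V s).
Proof.
move=> x1; rewrite {1 2}(proj_decomp s) vdot_shift// Feps_shift//.
by rewrite opprD addrACA subrr addr0.
Qed.

Lemma fenchel_simplex q : simplex q -> (Om q < +oo)%E.
Proof.
move=> sq; apply: le_lt_trans (ltry (Feps Y (- eps) 0)).
apply: fenchel_le => s; rewrite lerBlDl.
exact: le_trans (vdot_simplex_le n0 s sq) (vmax_le_Feps Y n0 eps s).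
Qed.

Lemma fenchel_dom q : (Om q < +oo)%E -> simplex q.
Proof.
move=> /fenchel_fin_num/fineK Om_q; set M := fine (Om q) in Om_q.
have hM s : vdot s q - F s <= M by rewrite -lee_fin Om_q fenchel_ge.
have F0c c : F (c *: const_mx 1) = F 0 + c by rewrite -Feps_shift// add0r.
(* An objective value of at least [B - F 0] exceeds the supposed supremum [M]. It is reached along
   [- e_i] if [q 0 i < 0], and along the all-one vector if the coordinates do not sum to 1. *)
pose B := `|M + F 0| + 1.
have B0 : M + F 0 < B by rewrite /B (le_lt_trans (ler_norm _))// ltrDl.
split=> [i|].
  rewrite leNgt; apply/negP => qi; pose c := B / - q 0 i.
  have Bp : 0 < B by rewrite /B ltr_pwDr.
  have c0 : 0 < c by rewrite divr_gt0// oppr_gt0.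
  have := hM (- c *: delta_mx 0 i); rewrite vdotZl vdot_delta.
  have -> : - c * q 0 i = B by rewrite /c mulNr -mulrN divfK// oppr_eq0 lt_eqF.
  have := Feps_le_vmax Y n0 eps (- c *: delta_mx 0 i).
  have [_ [j ->]] := vmax_attained (- c *: delta_mx 0 i : 'rV[R]_n) n0.
  rewrite !mxE; have : 0 <= c * (true && (j == i))%:R by rewrite mulr_ge0// ltW.
  by rewrite eqxx mulNr; lra.
apply/eqP; rewrite -subr_eq0; apply: contraT => S0.
set S := _ - 1 in S0; pose c := B / S.
have := hM (c *: const_mx 1); rewrite vdotZl vdot_const F0c.
have : c * S = B by rewrite /c divfK.
by rewrite /S; lra.
Qed.

Lemma fenchel_domE : [set q | (Om q < +oo)%E] = @simplex R n.
Proof.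
by apply/seteqP; split=> q; [exact: fenchel_dom|exact: fenchel_simplex].
Qed.

Lemma relint_fenchel_domP x :
  relint_in (@aff_simplex R n) (dom_in (@aff_simplex R n) Om) x <->
  (forall i, 0 < x 0 i) /\ \sum_i x 0 i = 1.
Proof.
split=> [[[x1 xoo] [e e0 he]]|[x0 x1]].
  have sx := fenchel_dom xoo; split=> // i.
  rewrite lt_neqAle sx.1 andbT eq_sym; apply/negP => /eqP xi.
  (* If [i] were the only index, its coordinate would be 1. *)
  have [j ji] : exists j, j != i.
    apply/existsP; apply: contraT; rewrite negb_exists => /forallP noj.
    move: x1; rewrite /aff_simplex/= big1 => [/eqP|j _]; first by rewrite eq_sym oner_eq0.
    by have := noj j; rewrite negbK => /eqP ->.
  (* Moving mass [e / 2] from [i] to [j] stays in the hyperplane and within [e] of [x], but makes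
     coordinate [i] negative. *)
  pose z := x + (e / 2) *: (delta_mx 0 j - delta_mx 0 i).
  have e20 : 0 < e / 2 by rewrite divr_gt0.
  have [||_ /fenchel_dom[/(_ i)]] := he z.
  - rewrite /aff_simplex/= -vdot_const vdotDr vdotZr vdotBr.
    rewrite !(vdotC _ (delta_mx _ _)) !vdot_delta !mxE subrr mulr0 addr0.
    by rewrite vdot_const.
  - rewrite (@le_lt_trans _ _ (e / 2))//; last by rewrite ltr_pdivrMr// ltr_pMr// ltr1n.
    apply: norm_row_le => [|k]; first exact: ltW.
    rewrite /z addrAC subrr add0r !mxE normrM (ger0_norm (ltW e20)); apply: ler_piMr (ltW e20) _.
    have [->|kj] := eqVneq k j; first by rewrite (negbTE ji) subr0 normr1.
    by rewrite sub0r normrN normr_nat lern1; case: (_ && _).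
  - by rewrite /z !mxE xi !eqxx eq_sym (negbTE ji) /= add0r; lra.
split; first by split=> //; apply: fenchel_simplex; split=> // i; exact: ltW.
exists (\big[Num.min/1]_i x 0 i); first exact: lt_bigmin.
move=> z z1 zx; split=> //; apply: fenchel_simplex; split=> // i.
have zi : `|(z - x) 0 i| < x 0 i.
  by rewrite (le_lt_trans (norm_coord_le _ _))// (lt_le_trans zx)// bigmin_le.
by move: zi; rewrite !mxE ltr_norml => /andP[]; lra.
Qed.

(** [vmax s - vdot s x] is the [x]-average of the nonnegative gaps [vmax s - s 0 j], hence at least
    [m] times each gap. A zero-sum [s] has coordinates of both weak signs, so the largest gap bounds
    the sup norm. *)
Lemma fenchel_coercive x (m : R) s : 0 < m -> (forall i, m <= x 0 i) ->
  \sum_i x 0 i = 1 -> Vdelta s ->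
  m * `|s| <= F s - vdot s x + Feps Y (- eps) 0.
Proof.
move=> m0 mx x1 Vs; have [ge_s _] := vmax_attained s n0.
have lb i : m * (vmax s - s 0 i) <= vmax s - vdot s x.
  rewrite -[vmax s in leRHS]mulr1 -x1 mulr_sumr -sumrB (bigD1 i)//=.
  rewrite -mulrBl -[leLHS]addr0 lerD//.
    by rewrite mulrC ler_wpM2l// subr_ge0.
  apply: sumr_ge0 => j _; rewrite -mulrBl mulr_ge0// ?subr_ge0//.
  exact: le_trans (ltW m0) (mx j).
have [k sk] : exists k, s 0 k <= 0.
  apply/existsP; apply: contraT; rewrite negb_exists => /forallP h.
  have : 0 < \sum_i s 0 i.
    rewrite (bigD1 (Ordinal n0))//= ltr_pwDl ?sumr_ge0//.
      by rewrite ltNge h.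
    by move=> i _; rewrite ltW// ltNge h.
  by rewrite Vs ltxx.
have [l sl] : exists l, 0 <= s 0 l.
  apply/existsP; apply: contraT; rewrite negb_exists => /forallP h.
  have : \sum_i s 0 i < 0.
    rewrite (bigD1 (Ordinal n0))//= -[ltRHS]addr0 ltr_leD ?sumr_le0//.
      by rewrite ltNge h.
    by move=> i _; rewrite ltW// ltNge h.
  by rewrite Vs ltxx.
have vs0 : 0 <= vmax s by exact: le_trans sl (ge_s l).
have := vmax_le_Feps Y n0 eps s.
suff : m * `|s| <= vmax s - vdot s x by lra.
rewrite -ler_pdivlMl//; apply: norm_row_le => [|i].
  apply: mulr_ge0; first by rewrite invr_ge0 ltW.
  apply: le_trans (lb k); apply: mulr_ge0; first exact: ltW.
  by rewrite subr_ge0.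
rewrite ler_pdivlMl//; have [si|si] := ger0P (s 0 i).
  apply: le_trans (lb k); rewrite ler_pM2l//; have := ge_s i.
  by lra.
by apply: le_trans (lb i); rewrite ler_pM2l//; lra.
Qed.

Lemma continuous_fenchel_obj x : continuous (fun s => F s - vdot s x).
Proof.
move=> s; apply: continuousB; first exact: continuous_Feps.
rewrite (_ : (fun s => vdot s x) = vdot x); first exact: continuous_vdot.
by apply/funext => v; rewrite vdotC.
Qed.

Lemma closed_Vdelta : closed (@Vdelta R n).
Proof. exact: closed_level (@continuous_row_sum R n). Qed.

Lemma fenchel_opt_exists x : (forall i, 0 < x 0 i) -> \sum_i x 0 i = 1 ->
  exists2 s, Vdelta s & fenchel_opt s x.
Proof.
move=> x0 x1; pose m := \big[Num.min/1]_i x 0 i.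
have m0 : 0 < m by exact: lt_bigmin.
have mx i : m <= x 0 i by exact: bigmin_le.
pose C := Feps Y (- eps) 0.
(* Beyond this radius coercivity pushes the objective above its value [F 0] at the origin. *)
pose M := (`|C| + `|F 0|) / m.
have M0 : 0 <= M by rewrite divr_ge0 ?addr_ge0// ltW.
pose K := @Vdelta R n `&` [set s | `|s| <= M].
have V0 : Vdelta (0 : 'rV[R]_n) by rewrite /Vdelta/= big1// => i _; rewrite mxE.
have compK : compact K.
  apply: bounded_closed_compact.
    exists M; split; first exact: num_real.
    by move=> N MN s [_ /= sM]; apply: le_trans sM (ltW MN).
  apply: closedI; first exact: closed_Vdelta.
  exact: closed_sublevel (@norm_continuous _ _).
have K0 : K !=set0 by exists 0; split=> //=; rewrite normr0.
have [s] := EVT_min_rV K0 compK (continuous_subspaceT (@continuous_fenchel_obj x)).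
rewrite inE => -[Vs _] smin; exists s => // s'.
rewrite (fenchel_obj_proj s' x1); set v := proj_V s'.
have Vv : Vdelta v by exact: proj_V_Vdelta.
suff : F s - vdot s x <= F v - vdot v x by lra.
have [vM|vM] := leP `|v| M; first by apply: smin; rewrite inE.
have : F s - vdot s x <= F 0 - vdot 0 x.
  by apply: smin; rewrite inE; split=> //=; rewrite normr0.
have := fenchel_coercive m0 mx x1 Vv; rewrite -/C vdot0l.
have : m * M < m * `|v| by rewrite ltr_pM2l.
rewrite /M mulrC divfK ?gt_eqF//.
by have := ler_norm C; have := ler_norm (F 0); lra.
Qed.

(** Strict convexity makes the loss positive on the sphere of radius [r] around [s], compactness
    makes it at least some [c], and convexity along rays extends it outwards with slope [c / r]. *)
Lemma fenchel_opt_margin s x r : Vdelta s -> fenchel_opt s x -> 0 < r ->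
  exists2 mu, 0 < mu & forall s', Vdelta s' -> r <= `|s' - s| ->
    mu * `|s' - s| <= (vdot s x - F s) - (vdot s' x - F s').
Proof.
move=> Vs so r0.
pose S := @Vdelta R n `&` [set v | `|v - s| = r].
pose G (v : 'rV[R]_n) : R := (vdot s x - F s) - (vdot v x - F v).
have cG : continuous G.
  rewrite (_ : G = (fun v => F v - vdot v x) - cst (F s - vdot s x)).
    move=> v; apply: continuousB; [exact: continuous_fenchel_obj|exact: cst_continuous].
  by apply/funext => v; rewrite /G !fctE; ring.
have cS : closed S.
  apply: closedI; first exact: closed_Vdelta.
  apply: closed_level; apply: (@lipschitz_continuous _ _ _ 1) => // a b.
  rewrite mul1r (le_trans (ler_dist_dist _ _))//.
  by rewrite opprB addrA subrK.
have [||c c0 hc] := compact_pos_lbound cS _ cG.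
- exists (`|s| + r) => v [_ /= vs]; rewrite -lerBlDl (le_trans (lerB_dist _ _))//.
  by rewrite vs.
- move=> v [Vv /= vs].
  have sv : v != s by apply: contraTneq r0 => vse; rewrite -vs vse subrr normr0 ltxx.
  have half : 0 < (2^-1 : R) < 1 by rewrite invr_gt0 invf_lt1 ?ltr1n ltr0n.
  have := Feps_strictly_convex n0 eps0 injY vertexY Vv Vs sv half.
  have := so (2^-1 *: v + (1 - 2^-1) *: s).
  rewrite vdotDl !vdotZl /G.
  set a := vdot s x; set b := vdot v x; set f := F s; set g := F v; lra.
exists (c / r); first by rewrite divr_gt0.
move=> v Vv rv; pose t := r / `|v - s|.
have vs0 : 0 < `|v - s| by exact: lt_le_trans rv.
have t0 : 0 < t by rewrite divr_gt0.
have t1 : t <= 1 by rewrite ler_pdivrMr// mul1r.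
have t01 : 0 <= t <= 1 by rewrite ltW.
have uS : S (t *: v + (1 - t) *: s).
  split.
    rewrite /Vdelta/= -vdot_const vdotDr !vdotZr !vdot_const.
    by move: Vv Vs; rewrite /Vdelta/= => -> ->; rewrite !mulr0 addr0.
  rewrite /= (_ : _ - s = t *: (v - s)); last by apply/rowP => i; rewrite !mxE; ring.
  by rewrite normrZ ger0_norm ?ltW// /t divfK// gt_eqF.
have := hc _ uS; have := Feps_convex Y n0 eps v s t01.
rewrite /G vdotDl !vdotZl => h1 h2.
have : c <= t * G v by rewrite /G; lra.
rewrite /t mulrAC ler_pdivlMr// => h3.
by rewrite mulrAC ler_pdivrMr// mulrC -[leRHS]mulrC mulrC -/(G v); lra.
Qed.

(** From below, [s] itself is a candidate at [x + h]. From above, candidates farther than [e / n]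
    lose more by the margin than [h] can give them, and nearer ones gain at most [e |h|]; [n] is the
    constant of [vdot_norm_le]. *)
Lemma fenchel_opt_grad s x : \sum_i x 0 i = 1 -> Vdelta s -> fenchel_opt s x ->
  grad_in (@Vdelta R n) Om x s.
Proof.
move=> x1 Vs so; split=> //; split; first by rewrite (fenchel_optE so).
move=> e e0; have nR : 0 < n%:R :> R by rewrite ltr0n.
have [mu mu0 hmu] := fenchel_opt_margin Vs so (divr_gt0 e0 nR).
exists (mu / n%:R) => [|h Vh hmuh]; first by rewrite divr_gt0.
have nh : n%:R * `|h| <= mu by rewrite mulrC -ler_pdivlMr// ltW.
pose A := vdot s x - F s + vdot s h.
have lbA : (A%:E <= Om (x + h))%E.
  by have := fenchel_ge s (x + h); rewrite vdotDr addrAC.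
have ubA : (Om (x + h) <= (A + e * `|h|)%:E)%E.
  apply: fenchel_le => s'.
  have xh1 : \sum_i (x + h) 0 i = 1.
    by rewrite -vdot_const vdotDr !vdot_const x1 (Vh : _ = 0) addr0.
  rewrite (fenchel_obj_proj s' xh1); set v := proj_V s'.
  have Vv : Vdelta v by exact: proj_V_Vdelta.
  have dot_le : vdot v h - vdot s h <= n%:R * `|h| * `|v - s|.
    rewrite -vdotBl (le_trans (ler_norm _))// (le_trans (vdot_norm_le _ _))//.
    by rewrite -mulrA [`|h| * _]mulrC.
  rewrite vdotDr /A.
  have [vr|vr] := leP (e / n%:R) `|v - s|.
    have := hmu _ Vv vr.
    have : n%:R * `|h| * `|v - s| <= mu * `|v - s| by rewrite ler_wpM2r.
    have : 0 <= e * `|h| by rewrite mulr_ge0// ltW.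
    lra.
  have : n%:R * `|h| * `|v - s| <= e * `|h|.
    rewrite mulrAC ler_wpM2r// mulrC -ler_pdivlMr//.
    exact: ltW.
  by have := so v; lra.
have fin_xh : Om (x + h) \is a fin_num.
  rewrite fin_real// (lt_le_trans (ltNyr _) lbA)/=.
  exact: le_lt_trans ubA (ltry _).
split=> //; rewrite (fenchel_optE so) /=.
move: lbA ubA; rewrite -(fineK fin_xh) !lee_fin /A => h1 h2.
by rewrite ger0_norm; lra.
Qed.

Lemma vdot_self_small (v : 'rV[R]_n) :
  (forall e, 0 < e -> vdot v v <= e * `|v|) -> v = 0.
Proof.
move=> h; apply/eqP; apply: contraT => v0.
have vv := vdot_self_gt0 v0; have nv : 0 < `|v| by rewrite normr_gt0.
have := h (vdot v v / (2 * `|v|)) _; rewrite divr_gt0 ?mulr_gt0// => /(_ isT).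
rewrite (_ : _ / _ * _ = vdot v v / 2); first by lra.
by field; rewrite gt_eqF.
Qed.

(** The direction [g - s] lies in [Vdelta]; testing both expansions on a small multiple of it meets
    the criterion of [vdot_self_small]. *)
Lemma grad_in_unique (f : 'rV[R]_n -> \bar R) x g s :
  grad_in (@Vdelta R n) f x g -> grad_in (@Vdelta R n) f x s -> g = s.
Proof.
move=> [Vg [_ hg]] [Vs [_ hs]]; apply/eqP; rewrite -subr_eq0; apply/eqP.
set v := g - s; apply: vdot_self_small => e e0.
have [v0|v0] := eqVneq v 0; first by rewrite v0 vdot0l normr0 mulr0.
have nv : 0 < `|v| by rewrite normr_gt0.
have e2 : 0 < e / 2 by rewrite divr_gt0.
have [r1 r10 h1] := hg _ e2; have [r2 r20 h2] := hs _ e2.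
pose r := Num.min r1 r2; have r0 : 0 < r by rewrite lt_min r10.
pose c := r / (2 * `|v|); have c0 : 0 < c by rewrite divr_gt0// mulr_gt0.
have nh : `|c *: v| = c * `|v| by rewrite normrZ gtr0_norm.
have nhr : `|c *: v| < r.
  by rewrite nh /c (_ : _ * _ = r / 2); [lra|field; rewrite gt_eqF].
have Vh : Vdelta (c *: v).
  rewrite /Vdelta/= -vdot_const vdotZr vdotBr !vdot_const.
  by rewrite (Vg : _ = 0) (Vs : _ = 0) subrr mulr0.
move: nhr; rewrite lt_min => /andP[nh1 nh2].
have [_] := h1 _ Vh nh1; have [_] := h2 _ Vh nh2.
rewrite !ler_norml nh => /andP[b1 b2] /andP[b3 b4].
have : vdot v (c *: v) <= e * (c * `|v|) by rewrite vdotBl; lra.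
by rewrite vdotZr mulrCA ler_pM2l.
Qed.

(** A subgradient at a point of differentiability is the gradient: optimality is tested at [s]
    displaced along their difference. *)
Lemma fenchel_opt_subgrad s x : fenchel_opt s x -> x = \row_i argmax_prob Y eps s i.
Proof.
move=> so; apply/eqP; rewrite -subr_eq0; apply/eqP; set g := \row_i _.
set v := x - g; apply: vdot_self_small => e e0.
have [v0|v0] := eqVneq v 0; first by rewrite v0 vdot0l normr0 mulr0.
have nv : 0 < `|v| by rewrite normr_gt0.
have [r r0 hr] := Feps_gradient n0 eps0 injY s e0.
pose c := r / `|v|; have c0 : 0 < c by rewrite divr_gt0.
have nh : `|c *: v| = c * `|v| by rewrite normrZ gtr0_norm.
have cr : c * `|v| = r by rewrite divfK// gt_eqF.
have := hr (c *: v); rewrite nh cr => /(_ (lexx _)).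
rewrite ler_norml => /andP[_]; have := so (s + c *: v).
rewrite -/g vdotDl !vdotZl => h1 h2.
have : c * vdot v v <= c * (e * `|v|).
  by rewrite [vdot v v]vdotBr mulrBr [leRHS]mulrCA cr; lra.
by rewrite ler_pM2l.
Qed.

Lemma fenchel_opt_coord s x i : fenchel_opt s x -> F s - F (s - delta_mx 0 i) <= x 0 i.
Proof.
by move=> /(_ (s - delta_mx 0 i)); rewrite vdotBl vdot_delta; lra.
Qed.

Lemma fenchel_strictly_convex :
  strictly_convex_on (relint_in (@aff_simplex R n) (dom_in (@aff_simplex R n) Om)) Om.
Proof.
move=> x y t /relint_fenchel_domP[x0 x1] /relint_fenchel_domP[y0 y1] xy /andP[t0 t1].
have sx : simplex x by split=> // i; exact: ltW.
have sy : simplex y by split=> // i; exact: ltW.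
set m := t *: x + (1 - t) *: y.
have m0 i : 0 < m 0 i by rewrite !mxE addr_gt0// mulr_gt0// subr_gt0.
have m1 : \sum_i m 0 i = 1.
  by rewrite -vdot_const vdotDr !vdotZr !vdot_const x1 y1; ring.
have [s Vs so] := fenchel_opt_exists m0 m1.
rewrite (fenchel_optE so).
have finx := fenchel_fin_num (fenchel_simplex sx).
have finy := fenchel_fin_num (fenchel_simplex sy).
have := fenchel_ge s y; have := fenchel_ge s x.
rewrite -(fineK finx) -(fineK finy) -!EFinM -EFinD !lee_fin lte_fin.
set X := fine _; set Z := fine _; set a := vdot s x - F s; set b := vdot s y - F s.
move=> aX bZ.
have -> : vdot s m - F s = t * a + (1 - t) * b.
  by rewrite /m vdotDr !vdotZr /a /b; ring.
(* Either the affine minorant given by [s] is strict at [x] or at [y], or [s] is optimal for both,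
   and then both equal the gradient of [F] at [s]. *)
have [aX'|Xa] := ltP a X.
  apply: ltr_leD; first by rewrite ltr_pM2l.
  by apply: ler_wpM2l => //; rewrite subr_ge0 ltW.
have [bZ'|Zb] := ltP b Z.
  apply: ler_ltD; first by rewrite ler_pM2l.
  by rewrite ltr_pM2l// subr_gt0.
have ox : fenchel_opt s x.
  move=> s'; rewrite -/a -lee_fin (le_trans (fenchel_ge s' x))// -(fineK finx) lee_fin.
  exact: Xa.
have oy : fenchel_opt s y.
  move=> s'; rewrite -/b -lee_fin (le_trans (fenchel_ge s' y))// -(fineK finy) lee_fin.
  exact: Zb.
case/negP: xy; apply/eqP.
exact: etrans (fenchel_opt_subgrad ox) (esym (fenchel_opt_subgrad oy)).
Qed.

Lemma fenchel_essentially_smooth :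
  essentially_smooth_in (@aff_simplex R n) (@Vdelta R n) Om.
Proof.
split; last split.
- have nR : 0 < n%:R :> R by rewrite ltr0n.
  exists (const_mx n%:R^-1); apply/relint_fenchel_domP; split=> [i|].
    by rewrite mxE invr_gt0.
  under eq_bigr do rewrite mxE.
  by rewrite sumr_const card_ord -[LHS]mulr_natl divff// gt_eqF.
- move=> x /relint_fenchel_domP[x0 x1]; have [s Vs so] := fenchel_opt_exists x0 x1.
  by exists s; exact: fenchel_opt_grad.
move=> u g x Du ux nDx gu.
(* By uniqueness of gradients each [g k] is the maximizer at [u k]. *)
have gopt k : fenchel_opt (g k) (u k).
  have /relint_fenchel_domP[u0 u1] := Du k.
  have [s Vs so] := fenchel_opt_exists u0 u1.
  by rewrite (grad_in_unique (gu k) (fenchel_opt_grad u1 Vs so)).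
have x1 : \sum_i x 0 i = 1.
  have cx : \sum_i u k 0 i @[k --> \oo] --> \sum_i x 0 i.
    exact: (continuous_cvg _ (@continuous_row_sum R n x) ux).
  have c1 : \sum_i u k 0 i @[k --> \oo] --> (1 : R).
    apply: cvg_near_cst; near=> k.
    by have /relint_fenchel_domP[] := Du k.
  exact: cvg_unique cx c1.
have [i xi] : exists i, x 0 i <= 0.
  apply/existsP; apply: contraT; rewrite negb_exists => /forallP h.
  by case: nDx; apply/relint_fenchel_domP; split=> // i; rewrite ltNge h.
apply/cvgryPge => A.
have cN : closed [set s : 'rV[R]_n | `|s| <= A].
  exact: closed_sublevel (@norm_continuous _ _).
have cI : continuous (fun s => F s - F (s - delta_mx 0 i)).
  apply: (@lipschitz_continuous _ _ _ 2) => // a b.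
  have := Feps_dist Y n0 eps a b.
  have := Feps_dist Y n0 eps (a - delta_mx 0 i) (b - delta_mx 0 i).
  rewrite (_ : _ - _ - (_ - _) = a - b); last by rewrite opprB addrA subrK.
  by rewrite !ler_norml => /andP[? ?] /andP[? ?]; apply/andP; split; lra.
(* Gradients of norm at most [A] would keep coordinate [i] of [u k] above [c > 0], while it tends to
   [x 0 i <= 0]. *)
have [c c0 hc] := compact_pos_lbound cN (ex_intro _ A (fun v vA => vA)) cI
  (fun v _ => Feps_incr n0 eps0 injY vertexY v i).
have ui : u k 0 i @[k --> \oo] --> x 0 i.
  exact: (continuous_cvg _ (@coord_continuous R 1 n 0 i x) ux).
have xc : x 0 i < c by exact: le_lt_trans c0.
near=> k; rewrite leNgt; apply/negP => gA.
have := le_trans (hc _ (ltW gA)) (fenchel_opt_coord i (gopt k)).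
rewrite leNgt => /negP; apply; near: k.
exact: (cvgr_lt _ ui).
Unshelve. all: by end_near.
Qed.

Lemma fenchel_legendre : legendre_in (@aff_simplex R n) (@Vdelta R n) Om.
Proof.
by split; [exact: fenchel_strictly_convex|exact: fenchel_essentially_smooth].
Qed.

End Conjugate.

Theorem theorem3 (R : realType) (d n : nat) (Y : 'M[R]_(d, n)) (eps : R) :
  (0 < n)%N ->
  (* the columns of Y are the (distinct) elements of the finite set \mathcal Y *)
  injective (fun i : 'I_n => col i Y) ->
  (* no element of \mathcal Y is a strict convex combination of the others *)
  (forall (i : 'I_n) (lam : 'rV[R]_n),
      (forall j, 0 <= lam 0 j < 1) -> lam 0 i = 0 ->
      \sum_(j < n) lam 0 j = 1 -> col i Y != Y *m lam^T) ->
  0 < eps ->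
  let F := Feps Y eps in
  [/\ (* (1) convex and Lipschitz *)
      (forall (s1 s2 : 'rV[R]_n) (t : R), 0 <= t <= 1 ->
         F (t *: s1 + (1 - t) *: s2) <= t * F s1 + (1 - t) * F s2) /\
      (exists k : R, forall s1 s2 : 'rV[R]_n, `|F s1 - F s2| <= k * `|s1 - s2|),
      (* (2) strictly convex on V_Delta, affine on span(1), decomposition *)
      [/\ (forall (s1 s2 : 'rV[R]_n) (t : R), @Vdelta R n s1 -> @Vdelta R n s2 ->
             s1 != s2 -> 0 < t < 1 ->
             F (t *: s1 + (1 - t) *: s2) < t * F s1 + (1 - t) * F s2),
          (forall c1 c2 t : R,
             F ((t * c1 + (1 - t) * c2) *: const_mx 1) =
             t * F (c1 *: const_mx 1) + (1 - t) * F (c2 *: const_mx 1)) &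
          (forall (s q0 : 'rV[R]_n), @simplex R n q0 ->
             F s = vdot (proj_perp s) q0 + F (proj_V s))],
      (* (3) differentiable, gradient = expected (a.s. unique) argmax *)
      (forall s : 'rV[R]_n, exists q : 'rV[R]_d -> 'rV[R]_n,
         gauss_prob [set z | argmax_simplex (s + eps *: (z *m Y)) <> [set q z]] = 0
         /\ differentiable F s
         /\ (forall h : 'rV[R]_n,
               'd F s h = \sum_(i < n) h 0 i * gauss_expect (fun z => q z 0 i))) &
      (* (4) the conjugate has domain Delta and is Legendre-type on H_Delta *)
      [set q | (fenchel F q < +oo)%E] = @simplex R n /\
      legendre_in (@aff_simplex R n) (@Vdelta R n) (fenchel F)].
Proof.
move=> n0 injY vertexY eps0 F; split.
- split; first by move=> s1 s2 t; exact: Feps_convex.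
  by exists 1 => s1 s2; rewrite mul1r; exact: Feps_dist.
- split.
  + exact: Feps_strictly_convex.
  + move=> c1 c2 t; have FE c : F (c *: const_mx 1) = F 0 + c.
      by rewrite -(Feps_shift Y n0 eps 0 c) add0r.
    by rewrite !FE; ring.
  + move=> s q0 [_ q1]; rewrite {1}(proj_decomp s) [F _]Feps_shift//.
    by rewrite vdotZl vdot_const q1 mulr1 addrC.
(* Off ties [vmax_row] is the unique maximizer, and its coordinates are the indicators whose
   expectations define [argmax_prob]. *)
- move=> s; exists (fun z => vmax_row (payoff Y eps s z)); split; last first.
    have [dF dE] := Feps_differentiable n0 eps0 injY s; split=> // h.
    rewrite dE; apply: eq_bigr => i _; rewrite mxE /argmax_prob.
    congr (_ * _).
    by congr gauss_expect; apply/funext => z; rewrite [RHS]mxE.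
  exact: gauss_prob_tie.
- split; first exact: fenchel_domE.
  exact: fenchel_legendre.
Qed.
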